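(* Let a plant $G(\Delta)$ of the unstructured class $\mathcal G_1$ and $\gamma>0$ be given, and put $l:=r+s$ for sizes (the lifted uncertainty channel has size $l\times l$). The following two statements are equivalent. (i) There exist an unstructured controller $K(\Delta)\in\mathcal K_1$ with $r^c=s^c=:l^c$, symmetric $\mathcal X_1\succ0$, symmetric $Z\succ0$ with $\mathrm{tr}(Z)<1$, and $\mathcal P\in\mathbf P$ such that the closed-loop matrices $\mathcal A_{ij},\mathcal B_i,\mathcal C_j$ of the lifted plant with $K(\Delta)$ satisfy $$N_1^T\begin{pmatrix}0&\mathcal X_1&0&0&0\\ \mathcal X_1&0&0&0&0\\0&0&0&\mathcal P&0\\0&0&\mathcal P&0&0\\0&0&0&0&-\gamma I\end{pmatrix}N_1\prec0,\qquad N_2^T\begin{pmatrix}-\mathcal X_1&0&0&0\\0&0&\mathcal P&0\\0&\mathcal P&0&0\\0&0&0&Z^{-1}\end{pmatrix}N_2\prec0,\tag{1}$$ $$N_1=\begin{pmatrix}I&0&0\\ \mathcal A_{11}&\mathcal A_{12}&\mathcal B_1\\0&I&0\\ \mathcal A_{21}&\mathcal A_{22}&\mathcal B_2\\0&0&I\end{pmatrix},\qquad N_2=\begin{pmatrix}I&0\\0&I\\ \mathcal A_{21}&\mathcal A_{22}\\ \mathcal C_1&\mathcal C_2\end{pmatrix}.$$ (ii) There exist symmetric $X_1,Y_1\in\mathbb R^{n\times n}$, $X_2\in\mathbf P_p$, $Y_2\in\mathbf P_d$, matrices $K_{11}\in\mathbb R^{n\times n}$, $K_{12}\in\mathbb R^{n\times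 l}$, $K_{21}\in\mathbb R^{l\times n}$, $K_{22}\in\mathbb R^{l\times l}$, $L_1\in\mathbb R^{n\times k}$, $L_2\in\mathbb R^{l\times k}$, $M_1\in\mathbb R^{m\times n}$, $M_2\in\mathbb R^{m\times l}$, $N\in\mathbb R^{m\times k}$, and symmetric $Z\succ0$ with $\mathrm{tr}(Z)<1$ such that, with $$\begin{pmatrix}\mathbb A_{ij}&\mathbb B_i\\ \mathbb C_j&\mathbb D\end{pmatrix}:=\begin{pmatrix}A_{ij}Y_j&A_{ij}&B_i^p\\0&X_i^TA_{ij}&X_i^TB_i^p\\ C_j^pY_j&C_j^p&D^p\end{pmatrix}+\begin{pmatrix}0&B_i\\ I&0\\0&E\end{pmatrix}\begin{pmatrix}K_{ij}&L_i\\ M_j&N\end{pmatrix}\begin{pmatrix}I&0&0\\0&C_j&F\end{pmatrix}\quad(i,j=1,2),$$ $$\mathbb X:=\begin{pmatrix}Y_1&I\\ I&X_1\end{pmatrix},$$ one has $\mathbb X\succ0$ and $$\mathbb N_1^T\begin{pmatrix}0&I&0&0&0\\ I&0&0&0&0\\0&0&0&I&0\\0&0&I&0&0\\0&0&0&0&-\gamma I\end{pmatrix}\mathbb N_1\prec0,\qquad \mathbb N_2^T\begin{pmatrix}-\mathbb X&0&0&0\\0&0&I&0\\0&I&0&0\\0&0&0&Z^{-1}\end{pmatrix}\mathbb N_2\prec0,\tag{2}$$ $$\mathbb N_1=\begin{pmatrix}I&0&0\\ \mathbb A_{11}&\mathbb A_{12}&\mathbb B_1\\0&I&0\\ \mathbb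 A_{21}&\mathbb A_{22}&\mathbb B_2\\0&0&I\end{pmatrix},\qquad \mathbb N_2=\begin{pmatrix}I&0\\0&I\\ \mathbb A_{21}&\mathbb A_{22}\\ \mathbb C_1&\mathbb C_2\end{pmatrix}.$$ Moreover, if (ii) holds, then there exist $\mathcal X_1\succ0$, $\mathcal P\in\mathbf P$ and $K(\Delta)\in\mathcal K_1$ with an affine scheduling function $\hat\Delta_c(\cdot)$ and with $n^c\le n$, $l^c\le l$ such that (1) is satisfied.
   Context: All matrices are real. $\prec 0$/$\succ0$ mean negative/positive definite for symmetric matrices. $\mathbf V=\mathrm{Co}\{\Delta_1,\dots,\Delta_N\}\subset\mathbb R^{r_\Delta\times s_\Delta}$ is the convex hull of finitely many matrices, with $0\in\mathbf V$. Class $\mathcal G_1$ (plants): real matrices of compatible dimensions defining $$\begin{pmatrix}\dot x\\ \hat z\\ z_p\\ y\end{pmatrix}=\begin{pmatrix}\hat A_{11}&\hat A_{12}&\hat B_1^p&\hat B_1\\ \hat A_{21}&\hat A_{22}&\hat B_2^p&\hat B_2\\ \hat C_1^p&\hat C_2^p&\hat D^p&\hat E\\ \hat C_1&\hat C_2&\hat F&0\end{pmatrix}\begin{pmatrix}x\\ \hat w\\ w_p\\ u\end{pmatrix},\quad \hat w=\hat\Delta(\Delta)\hat z,\quad \hat\Delta(\Delta):=\Delta,$$ with $x\in\mathbb R^n$, $\hat w\in\mathbb R^r$, $\hat z\in\mathbb R^s$, $w_p\in\mathbb R^{m^p}$, $z_p\in\mathbb R^{k^p}$, $u\in\mathbb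 R^m$, $y\in\mathbb R^k$, $(r,s)=(r_\Delta,s_\Delta)$ (zero feedthrough $u\to y$). Class $\mathcal K_1$ (controllers): arbitrary matrices $\hat A^c_{ij},\hat B^c_i,\hat C^c_j,\hat D^c$ and an arbitrary function $\hat\Delta_c:\mathbf V\to\mathbb R^{r^c\times s^c}$ (arbitrary sizes $n^c,r^c,s^c\in\mathbb N_0$) defining $$\begin{pmatrix}\dot x_c\\ \hat z_c\\ u\end{pmatrix}=\begin{pmatrix}\hat A^c_{11}&\hat A^c_{12}&\hat B^c_1\\ \hat A^c_{21}&\hat A^c_{22}&\hat B^c_2\\ \hat C^c_1&\hat C^c_2&\hat D^c\end{pmatrix}\begin{pmatrix}x_c\\ \hat w_c\\ y\end{pmatrix},\quad \hat w_c=\hat\Delta_c(\Delta)\hat z_c,\quad x_c\in\mathbb R^{n^c}.$$ Lifted plant: $A_{11}=\hat A_{11}$, $A_{12}=(\hat A_{12}\ \ 0_{n\times s})$, $A_{21}=\begin{pmatrix}0\\2\hat A_{21}\end{pmatrix}$, $A_{22}=\begin{pmatrix}I_r&0\\2\hat A_{22}&-I_s\end{pmatrix}$, $B_1^p=\hat B_1^p$, $B_2^p=\begin{pmatrix}0\\2\hat B_2^p\end{pmatrix}$, $B_1=\hat B_1$, $B_2=\begin{pmatrix}0\\2\hat B_2\end{pmatrix}$, $C_1^p=\hat C_1^p$, $C_2^p=(\hat C_2^p\ \ 0)$, $C_1=\hat C_1$, $C_2=(\hat C_2\ \ 0)$, $D^p=\hat D^p$, $E=\hat E$, $F=\hat F$,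 $\Delta_l(\Delta)=\begin{pmatrix}-I_r&2\hat\Delta(\Delta)\\0&I_s\end{pmatrix}$. Closed loop of the lifted plant with the controller, $r^c=s^c=l^c$: for $i,j=1,2$, $$\begin{pmatrix}\mathcal A_{ij}&\mathcal B_i\\ \mathcal C_j&\mathcal D\end{pmatrix}=\begin{pmatrix}A_{ij}&0&B_i^p\\0&0&0\\ C_j^p&0&D^p\end{pmatrix}+\begin{pmatrix}0&B_i\\ I&0\\0&E\end{pmatrix}\begin{pmatrix}\hat A^c_{ij}&\hat B^c_i\\ \hat C^c_j&\hat D^c\end{pmatrix}\begin{pmatrix}0&I&0\\ C_j&0&F\end{pmatrix},$$ $\Delta_{lc}(\Delta):=\mathrm{diag}(\Delta_l(\Delta),\hat\Delta_c(\Delta))$, and $\mathbf P$ (depending on $\hat\Delta_c$) is the set of symmetric $\mathcal P$ of size $r+s+l^c$ with $\begin{pmatrix}\Delta_{lc}(\Delta)\\ I\end{pmatrix}^T\begin{pmatrix}0&\mathcal P\\ \mathcal P&0\end{pmatrix}\begin{pmatrix}\Delta_{lc}(\Delta)\\ I\end{pmatrix}\succ0$ for all $\Delta\in\mathbf V$. Primal scalings: $\mathbf P_p$ is the set of symmetric $P\in\mathbb R^{(r+s)\times(r+s)}$ with $\begin{pmatrix}I_r\\0\end{pmatrix}^TP\begin{pmatrix}I_r\\0\end{pmatrix}\prec0$ and $\begin{pmatrix}\hat\Delta(\Delta)\\ I_s\end{pmatrix}^TP\begin{pmatrix}\hat\Delta(\Delta)\\ I_s\end{pmatrix}\succ0$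 for all $\Delta\in\mathbf V$. Dual scalings: $\mathbf P_d$ is the set of symmetric $\tilde P\in\mathbb R^{(r+s)\times(r+s)}$ with $\begin{pmatrix}0\\ I_s\end{pmatrix}^T\tilde P\begin{pmatrix}0\\ I_s\end{pmatrix}\succ0$ and $\begin{pmatrix}I_r\\-\hat\Delta(\Delta)^T\end{pmatrix}^T\tilde P\begin{pmatrix}I_r\\-\hat\Delta(\Delta)^T\end{pmatrix}\prec0$ for all $\Delta\in\mathbf V$. *)

(* Defs.v *)
From mathcomp Require Import all_boot all_order all_algebra reals.
Set Implicit Arguments.
Unset Strict Implicit.
Unset Printing Implicit Defensive.
Import Order.TTheory GRing.Theory Num.Theory.
Local Open Scope ring_scope.

Definition posdef (R : realType) (n : nat) (A : 'M[R]_n) : Prop :=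
  A \is symmetricmx /\
  forall x : 'cV[R]_n, x != 0 -> 0 < (x^T *m A *m x) 0 0.

Definition negdef (R : realType) (n : nat) (A : 'M[R]_n) : Prop :=
  A \is symmetricmx /\
  forall x : 'cV[R]_n, x != 0 -> (x^T *m A *m x) 0 0 < 0.

Definition conv_hull (R : realType) (r s N : nat) (V : 'I_N -> 'M[R]_(r, s))
    (Delta : 'M[R]_(r, s)) : Prop :=
  exists a : 'I_N -> R,
    [/\ forall i, 0 <= a i, \sum_i a i = 1 & Delta = \sum_i a i *: V i].

Section Systems.
Variable R : realType.

(* x' = A11 x + A12 w + Bp1 wp + B1 u,   z = A21 x + A22 w + Bp2 wp + B2 u,
   zp = Cp1 x + Cp2 w + Dp wp + E u,     y = C1 x + C2 w + F wp,
   with x in R^n, w in R^r, z in R^s, wp in R^mp, zp in R^kp, u in R^m and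
   y in R^k; there is no feedthrough from u to y. *)
Record plant (n r s mp kp m k : nat) := Plant {
  pA11 : 'M[R]_(n, n);  pA12 : 'M[R]_(n, r);
  pBp1 : 'M[R]_(n, mp); pB1 : 'M[R]_(n, m);
  pA21 : 'M[R]_(s, n);  pA22 : 'M[R]_(s, r);
  pBp2 : 'M[R]_(s, mp); pB2 : 'M[R]_(s, m);
  pCp1 : 'M[R]_(kp, n); pCp2 : 'M[R]_(kp, r);
  pDp : 'M[R]_(kp, mp); pE : 'M[R]_(kp, m);
  pC1 : 'M[R]_(k, n);   pC2 : 'M[R]_(k, r);
  pF : 'M[R]_(k, mp) }.

(* xc' = A11 xc + A12 wc + B1 y, zc = A21 xc + A22 wc + B2 y,
   u = C1 xc + C2 wc + D y, wc = sched Delta *m zc. The scheduling function is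
   represented by a function on all of R^(r x s), of which only the values on
   the uncertainty set are ever used. *)
Record controller (r s nc rc sc m k : nat) := Controller {
  kA11 : 'M[R]_(nc, nc); kA12 : 'M[R]_(nc, rc); kB1 : 'M[R]_(nc, k);
  kA21 : 'M[R]_(sc, nc); kA22 : 'M[R]_(sc, rc); kB2 : 'M[R]_(sc, k);
  kC1 : 'M[R]_(m, nc);   kC2 : 'M[R]_(m, rc);   kD : 'M[R]_(m, k);
  sched : 'M[R]_(r, s) -> 'M[R]_(rc, sc) }.

Definition affine_sched (r s nc rc sc m k : nat) (V : 'M[R]_(r, s) -> Prop)
    (K : controller r s nc rc sc m k) : Prop :=
  exists (K0 : 'M[R]_(rc, sc)) (L : {linear 'M[R]_(r, s) -> 'M[R]_(rc, sc)}),
    forall Delta, V Delta -> sched K Delta = K0 + L Delta.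

Definition lift_plant (n r s mp kp m k : nat) (G : plant n r s mp kp m k) :
    plant n (r + s) (r + s) mp kp m k :=
  {| pA11 := pA11 G;
     pA12 := row_mx (pA12 G) 0;
     pBp1 := pBp1 G;
     pB1 := pB1 G;
     pA21 := col_mx 0 (2 *: pA21 G);
     pA22 := block_mx 1%:M 0 (2 *: pA22 G) (- 1%:M);
     pBp2 := col_mx 0 (2 *: pBp2 G);
     pB2 := col_mx 0 (2 *: pB2 G);
     pCp1 := pCp1 G;
     pCp2 := row_mx (pCp2 G) 0;
     pDp := pDp G;
     pE := pE G;
     pC1 := pC1 G;
     pC2 := row_mx (pC2 G) 0;
     pF := pF G |}.

Definition lift_Delta (r s : nat) (Delta : 'M[R]_(r, s)) : 'M[R]_(r + s) :=
  block_mx (- 1%:M) (2 *: Delta) 0 1%:M.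

(* A system with state in R^x, uncertainty channel of size w x w, and
   performance channel from R^q to R^p. *)
Record perf_sys (x w q p : nat) := PerfSys {
  sA11 : 'M[R]_(x, x); sA12 : 'M[R]_(x, w); sB1 : 'M[R]_(x, q);
  sA21 : 'M[R]_(w, x); sA22 : 'M[R]_(w, w); sB2 : 'M[R]_(w, q);
  sC1 : 'M[R]_(p, x);  sC2 : 'M[R]_(p, w);  sD : 'M[R]_(p, q) }.

(* [Mij] is the matrix (A_ij, B_i; C_j, D). Its B-block does not depend on j,
   its C-block does not depend on i and its D-block on neither in both uses
   below, so that they may be read off the diagonal. *)
Definition perf_sys_of (x w q p : nat)
    (M11 : 'M[R]_(x + p, x + q)) (M12 : 'M[R]_(x + p, w + q))
    (M21 : 'M[R]_(w + p, x + q)) (M22 : 'M[R]_(w + p, w + q)) :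
    perf_sys x w q p :=
  {| sA11 := ulsubmx M11; sA12 := ulsubmx M12; sB1 := ursubmx M11;
     sA21 := ulsubmx M21; sA22 := ulsubmx M22; sB2 := ursubmx M22;
     sC1 := dlsubmx M11;  sC2 := dlsubmx M22;  sD := drsubmx M11 |}.

Definition closed_loop_block (a b ac bc mp kp m k : nat)
    (A : 'M[R]_(a, b)) (Bp : 'M[R]_(a, mp)) (B : 'M[R]_(a, m))
    (Cp : 'M[R]_(kp, b)) (C : 'M[R]_(k, b))
    (Dp : 'M[R]_(kp, mp)) (E : 'M[R]_(kp, m)) (F : 'M[R]_(k, mp))
    (Ac : 'M[R]_(ac, bc)) (Bc : 'M[R]_(ac, k))
    (Cc : 'M[R]_(m, bc)) (Dc : 'M[R]_(m, k)) :
    'M[R]_((a + ac) + kp, (b + bc) + mp) :=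
  block_mx (block_mx A 0 0 0) (col_mx Bp 0) (row_mx Cp 0) Dp
  + col_mx (block_mx 0 B 1%:M 0) (row_mx 0 E)
    *m block_mx Ac Bc Cc Dc
    *m row_mx (block_mx 0 1%:M C 0) (col_mx 0 F).

Definition closed_loop (r s n l mp kp m k nc lc : nat)
    (G : plant n l l mp kp m k) (K : controller r s nc lc lc m k) :
    perf_sys (n + nc) (l + lc) mp kp :=
  perf_sys_of
    (closed_loop_block (pA11 G) (pBp1 G) (pB1 G) (pCp1 G) (pC1 G)
       (pDp G) (pE G) (pF G) (kA11 K) (kB1 K) (kC1 K) (kD K))
    (closed_loop_block (pA12 G) (pBp1 G) (pB1 G) (pCp2 G) (pC2 G)
       (pDp G) (pE G) (pF G) (kA12 K) (kB1 K) (kC2 K) (kD K))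
    (closed_loop_block (pA21 G) (pBp2 G) (pB2 G) (pCp1 G) (pC1 G)
       (pDp G) (pE G) (pF G) (kA21 K) (kB2 K) (kC1 K) (kD K))
    (closed_loop_block (pA22 G) (pBp2 G) (pB2 G) (pCp2 G) (pC2 G)
       (pDp G) (pE G) (pF G) (kA22 K) (kB2 K) (kC2 K) (kD K)).

Definition closed_loop_Delta (r s nc lc m k : nat)
    (K : controller r s nc lc lc m k) (Delta : 'M[R]_(r, s)) :
    'M[R]_((r + s) + lc) :=
  block_mx (lift_Delta Delta) 0 0 (sched K Delta).

Record design_params (n l m k : nat) := DesignParams {
  dK11 : 'M[R]_(n, n); dK12 : 'M[R]_(n, l); dL1 : 'M[R]_(n, k);
  dK21 : 'M[R]_(l, n); dK22 : 'M[R]_(l, l); dL2 : 'M[R]_(l, k);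
  dM1 : 'M[R]_(m, n);  dM2 : 'M[R]_(m, l);  dN : 'M[R]_(m, k) }.

Definition design_block (a b mp kp m k : nat)
    (A : 'M[R]_(a, b)) (Bp : 'M[R]_(a, mp)) (B : 'M[R]_(a, m))
    (Cp : 'M[R]_(kp, b)) (C : 'M[R]_(k, b))
    (Dp : 'M[R]_(kp, mp)) (E : 'M[R]_(kp, m)) (F : 'M[R]_(k, mp))
    (X : 'M[R]_(a, a)) (Y : 'M[R]_(b, b))
    (K : 'M[R]_(a, b)) (L : 'M[R]_(a, k))
    (M : 'M[R]_(m, b)) (N : 'M[R]_(m, k)) :
    'M[R]_((a + a) + kp, (b + b) + mp) :=
  block_mx (block_mx (A *m Y) A 0 (X^T *m A)) (col_mx Bp (X^T *m Bp))
           (row_mx (Cp *m Y) Cp) Dp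
  + col_mx (block_mx 0 B 1%:M 0) (row_mx 0 E)
    *m block_mx K L M N
    *m row_mx (block_mx 1%:M 0 0 C) (col_mx 0 F).

Definition design_sys (n l mp kp m k : nat) (G : plant n l l mp kp m k)
    (X1 Y1 : 'M[R]_n) (X2 Y2 : 'M[R]_l) (T : design_params n l m k) :
    perf_sys (n + n) (l + l) mp kp :=
  perf_sys_of
    (design_block (pA11 G) (pBp1 G) (pB1 G) (pCp1 G) (pC1 G)
       (pDp G) (pE G) (pF G) X1 Y1 (dK11 T) (dL1 T) (dM1 T) (dN T))
    (design_block (pA12 G) (pBp1 G) (pB1 G) (pCp2 G) (pC2 G)
       (pDp G) (pE G) (pF G) X1 Y2 (dK12 T) (dL1 T) (dM2 T) (dN T))
    (design_block (pA21 G) (pBp2 G) (pB2 G) (pCp1 G) (pC1 G)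
       (pDp G) (pE G) (pF G) X2 Y1 (dK21 T) (dL2 T) (dM1 T) (dN T))
    (design_block (pA22 G) (pBp2 G) (pB2 G) (pCp2 G) (pC2 G)
       (pDp G) (pE G) (pF G) X2 Y2 (dK22 T) (dL2 T) (dM2 T) (dN T)).

Definition primal_scaling (r s : nat) (V : 'M[R]_(r, s) -> Prop)
    (P : 'M[R]_(r + s)) : Prop :=
  [/\ P \is symmetricmx,
      (let J : 'M[R]_(r + s, r) := col_mx 1%:M 0 in negdef (J^T *m P *m J)) &
      forall Delta, V Delta ->
        let J : 'M[R]_(r + s, s) := col_mx Delta 1%:M in
        posdef (J^T *m P *m J)].

Definition dual_scaling (r s : nat) (V : 'M[R]_(r, s) -> Prop)
    (P : 'M[R]_(r + s)) : Prop :=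
  [/\ P \is symmetricmx,
      (let J : 'M[R]_(r + s, s) := col_mx 0 1%:M in posdef (J^T *m P *m J)) &
      forall Delta, V Delta ->
        let J : 'M[R]_(r + s, r) := col_mx 1%:M (- Delta^T) in
        negdef (J^T *m P *m J)].

Definition antidiag (n : nat) (P : 'M[R]_n) : 'M[R]_(n + n) :=
  block_mx 0 P P 0.

Definition closed_loop_scaling (r s nc lc m k : nat)
    (V : 'M[R]_(r, s) -> Prop) (K : controller r s nc lc lc m k)
    (P : 'M[R]_((r + s) + lc)) : Prop :=
  P \is symmetricmx /\
  forall Delta, V Delta ->
    let J := col_mx (closed_loop_Delta K Delta) 1%:M in
    posdef (J^T *m antidiag P *m J).

Definition outer1 (x w q p : nat) (S : perf_sys x w q p) :
    'M[R]_((x + x) + (w + w) + q, (x + w) + q) :=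
  col_mx
    (col_mx (col_mx (row_mx (row_mx 1%:M 0) 0)
                    (row_mx (row_mx (sA11 S) (sA12 S)) (sB1 S)))
            (col_mx (row_mx (row_mx 0 1%:M) 0)
                    (row_mx (row_mx (sA21 S) (sA22 S)) (sB2 S))))
    (row_mx (row_mx 0 0) 1%:M).

Definition outer2 (x w q p : nat) (S : perf_sys x w q p) :
    'M[R]_(x + (w + w) + p, x + w) :=
  col_mx
    (col_mx (row_mx 1%:M 0)
            (col_mx (row_mx 0 1%:M)
                    (row_mx (sA21 S) (sA22 S))))
    (row_mx (sC1 S) (sC2 S)).

Definition middle1 (x w q : nat) (X : 'M[R]_x) (P : 'M[R]_w) (gamma : R) :
    'M[R]_((x + x) + (w + w) + q) :=
  block_mx (block_mx (antidiag X) 0 0 (antidiag P)) 0 0 (- gamma%:M).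

(* [U] is the full upper left block, sign included. *)
Definition middle2 (x w p : nat) (U : 'M[R]_x) (P : 'M[R]_w) (Z : 'M[R]_p) :
    'M[R]_(x + (w + w) + p) :=
  block_mx (block_mx U 0 0 (antidiag P)) 0 0 (invmx Z).

Definition analysis_lmis (n r s mp kp m k nc lc : nat)
    (V : 'M[R]_(r, s) -> Prop) (G : plant n r s mp kp m k) (gamma : R)
    (K : controller r s nc lc lc m k)
    (X1 : 'M[R]_(n + nc)) (P : 'M[R]_((r + s) + lc)) (Z : 'M[R]_kp) : Prop :=
  let S := closed_loop (lift_plant G) K in
  [/\ posdef X1, posdef Z /\ \tr Z < 1, closed_loop_scaling V K P,
      negdef ((outer1 S)^T *m middle1 mp X1 P gamma *m outer1 S) &
      negdef ((outer2 S)^T *m middle2 (- X1) P Z *m outer2 S)].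

Definition design_lmis (n r s mp kp m k : nat)
    (V : 'M[R]_(r, s) -> Prop) (G : plant n r s mp kp m k) (gamma : R)
    (X1 Y1 : 'M[R]_n) (X2 Y2 : 'M[R]_(r + s))
    (T : design_params n (r + s) m k) (Z : 'M[R]_kp) : Prop :=
  let S := design_sys (lift_plant G) X1 Y1 X2 Y2 T in
  let XX : 'M[R]_(n + n) := block_mx Y1 1%:M 1%:M X1 in
  [/\ X1 \is symmetricmx /\ Y1 \is symmetricmx,
      primal_scaling V X2 /\ dual_scaling V Y2,
      posdef Z /\ \tr Z < 1,
      posdef XX &
      negdef ((outer1 S)^T *m middle1 mp 1%:M 1%:M gamma *m outer1 S) /\
      negdef ((outer2 S)^T *m middle2 (- XX) 1%:M Z *m outer2 S)].

End Systems.

(* Main.v *)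
Require Import Defs.
From mathcomp Require Import all_boot all_order all_algebra reals.
From HB Require Import structures.
From mathcomp Require Import ring lra.
Import Order.TTheory GRing.Theory Num.Theory.
Local Open Scope ring_scope.
Set Implicit Arguments.
Unset Strict Implicit.
Unset Printing Implicit Defensive.

(* Let R_i = (Y_i, I; W_i, 0), where Y_1, W_1 form the first block column of the
   inverse of the closed-loop Lyapunov matrix and Y_2, W_2 that of the inverse of
   the scaling P. The congruence with diag(R_1, R_2, I) turns the analysis LMIs
   into the design LMIs, for parameters K, L, M, N that depend on the controller.
   In the lifted channel Delta_l has the eigenvalues -1 and 1, with eigenspaces
   im(I; 0) and im(Delta; I), so that X_2 is a primal scaling iff
   Delta_l^T X_2 + X_2 Delta_l is positive definite on the hull; dually for Y_2.

   From analysis to design, the R_i may fail to be injective; a perturbation of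
   X_1, K_11 and K_22 restores strictness by Finsler's lemma. From design to
   analysis, X_2 is shifted so that X_2 - Y_2^-1 is invertible; then W_i = Y_i
   gives square invertible R_i, the controller is obtained by solving linear
   equations, and its scheduling function is chosen to cancel the off-diagonal
   blocks of the scaling condition, which makes it affine in Delta. *)

(** * Quadratic forms, coercivity and Finsler's lemma *)

Section QuadraticForms.
Variable R : realType.
Implicit Types (n m p : nat).

Definition bil n m (M : 'M[R]_(n, m)) (x : 'cV[R]_n) (y : 'cV[R]_m) : R :=
  (x^T *m M *m y) 0 0.

Definition quad n (M : 'M[R]_n) (x : 'cV[R]_n) : R := bil M x x.

(** Symmetry is not demanded, so that Lyapunov products such as [X *m N] and block triangular
    matrices can be treated without symmetrization. *)
Definition posform n (M : 'M[R]_n) : Prop := forall x, x != 0 -> 0 < quad M x.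

Lemma bilDl n m (M : 'M[R]_(n, m)) x1 x2 y :
  bil M (x1 + x2) y = bil M x1 y + bil M x2 y.
Proof. by rewrite /bil linearD /= !mulmxDl mxE. Qed.

Lemma bilDr n m (M : 'M[R]_(n, m)) x y1 y2 :
  bil M x (y1 + y2) = bil M x y1 + bil M x y2.
Proof. by rewrite /bil mulmxDr mxE. Qed.

Lemma bilDm n m (M N : 'M[R]_(n, m)) x y : bil (M + N) x y = bil M x y + bil N x y.
Proof. by rewrite /bil mulmxDr mulmxDl mxE. Qed.

Lemma bilZl n m (M : 'M[R]_(n, m)) c x y : bil M (c *: x) y = c * bil M x y.
Proof. by rewrite /bil linearZ /= -!scalemxAl mxE. Qed.

Lemma bilZr n m (M : 'M[R]_(n, m)) c x y : bil M x (c *: y) = c * bil M x y.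
Proof. by rewrite /bil -scalemxAr mxE. Qed.

Lemma bilZm n m (M : 'M[R]_(n, m)) c x y : bil (c *: M) x y = c * bil M x y.
Proof. by rewrite /bil -scalemxAr -scalemxAl mxE. Qed.

Lemma bilNm n m (M : 'M[R]_(n, m)) x y : bil (- M) x y = - bil M x y.
Proof. by rewrite -scaleN1r bilZm mulN1r. Qed.

Lemma bilNl n m (M : 'M[R]_(n, m)) x y : bil M (- x) y = - bil M x y.
Proof. by rewrite -scaleN1r bilZl mulN1r. Qed.

Lemma bilNr n m (M : 'M[R]_(n, m)) x y : bil M x (- y) = - bil M x y.
Proof. by rewrite -scaleN1r bilZr mulN1r. Qed.

Lemma bil0l n m (M : 'M[R]_(n, m)) y : bil M 0 y = 0.
Proof. by rewrite /bil trmx0 !mul0mx mxE. Qed.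

Lemma bil0r n m (M : 'M[R]_(n, m)) x : bil M x 0 = 0.
Proof. by rewrite /bil mulmx0 mxE. Qed.

Lemma bil0m n m x y : bil (0 : 'M[R]_(n, m)) x y = 0.
Proof. by rewrite /bil mulmx0 mul0mx mxE. Qed.

Lemma bil_tr n m (M : 'M[R]_(n, m)) x y : bil M^T y x = bil M x y.
Proof.
rewrite /bil; have -> : x^T *m M *m y = (y^T *m M^T *m x)^T.
  by rewrite !trmx_mul !trmxK mulmxA.
by rewrite [RHS]mxE.
Qed.

Lemma bilMr n m p (M : 'M[R]_(n, m)) (N : 'M[R]_(m, p)) x y :
  bil (M *m N) x y = bil M x (N *m y).
Proof. by rewrite /bil !mulmxA. Qed.

Lemma bilMl n m p (M : 'M[R]_(n, m)) (N : 'M[R]_(m, p)) x y :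
  bil (M *m N) x y = bil N (M^T *m x) y.
Proof. by rewrite /bil trmx_mul trmxK !mulmxA. Qed.

Lemma bil_block n1 n2 m1 m2 (A : 'M[R]_(n1, m1)) (B : 'M[R]_(n1, m2))
    (C : 'M[R]_(n2, m1)) (D : 'M[R]_(n2, m2)) a b c d :
  bil (block_mx A B C D) (col_mx a b) (col_mx c d)
  = bil A a c + bil B a d + (bil C b c + bil D b d).
Proof.
rewrite /bil tr_col_mx mul_row_block mul_row_col !mulmxDl !mxE; ring.
Qed.

Lemma bil_col n1 n2 m (A : 'M[R]_(n1, m)) (B : 'M[R]_(n2, m)) a b c :
  bil (col_mx A B) (col_mx a b) c = bil A a c + bil B b c.
Proof. by rewrite /bil tr_col_mx mul_row_col mulmxDl mxE. Qed.

Lemma quad_congr n p (T : 'M[R]_(n, p)) M x :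
  quad (T^T *m M *m T) x = quad M (T *m x).
Proof. by rewrite /quad bilMr bilMl trmxK. Qed.

Lemma quad1E n (x : 'cV[R]_n) : quad 1%:M x = \sum_i x i 0 ^+ 2.
Proof.
by rewrite /quad /bil mulmx1 mxE; apply: eq_bigr => i _; rewrite mxE expr2.
Qed.

Lemma quad1_ge0 n (x : 'cV[R]_n) : 0 <= quad 1%:M x.
Proof. by rewrite quad1E; apply: sumr_ge0 => i _; apply: sqr_ge0. Qed.

Lemma quad1_gt0 n : posform (1%:M : 'M[R]_n).
Proof.
move=> x x0; rewrite lt_def quad1_ge0 andbT; apply: contra x0 => /eqP e.
apply/eqP/colP => i; rewrite mxE; apply/eqP; rewrite -sqrf_eq0.
move: e; rewrite quad1E => /eqP.
rewrite psumr_eq0 => [/allP /(_ i)|j _]; last exact: sqr_ge0.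
by rewrite mem_index_enum => /(_ isT).
Qed.

Lemma sqr_coord_le n (x : 'cV[R]_n) i : x i 0 ^+ 2 <= quad 1%:M x.
Proof.
by rewrite quad1E (bigD1 i) //= lerDl; apply: sumr_ge0 => j _; apply: sqr_ge0.
Qed.

Lemma posform_congr n p (T : 'M[R]_(n, p)) M :
  (forall x : 'cV_p, x != 0 -> T *m x != 0) -> posform M -> posform (T^T *m M *m T).
Proof. by move=> inj pM x x0; rewrite quad_congr; apply/pM/inj. Qed.

Lemma unitmx_inj n (T : 'M[R]_n) (x : 'cV_n) :
  T \in unitmx -> x != 0 -> T *m x != 0.
Proof.
by move=> uT; apply: contra => /eqP e; rewrite -(mulKmx uT x) e mulmx0.
Qed.

Lemma posform_congrW n (T M : 'M[R]_n) :
  T \in unitmx -> posform (T^T *m M *m T) -> posform M.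
Proof.
move=> uT pM x x0; rewrite -(mulKVmx uT x) -quad_congr; apply: pM.
by apply: unitmx_inj => //; rewrite unitmx_inv.
Qed.

Lemma posform_tr n (M : 'M[R]_n) : posform M -> posform M^T.
Proof. by move=> pM x /pM; rewrite /quad bil_tr. Qed.

Lemma posform_unit n (M : 'M[R]_n) : posform M -> M \in unitmx.
Proof.
move=> pM; rewrite -row_free_unit -kermx_eq0; apply/rowV0P => v.
move=> /sub_kermxP vM; apply/eqP; apply: contraT => v0.
have /pM : v^T != 0 by rewrite -trmx0 (inj_eq trmx_inj).
by rewrite /quad /bil trmxK vM mul0mx mxE ltxx.
Qed.

(** Instead of compactness of the sphere: in the inner product of [S = M + M^T], Cauchy-Schwarz
    against the vector representing the i-th coordinate gives [x_i^2 <= (S^-1)_ii * quad S x]. These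
    bounds are summed over i. *)
Lemma posform_coercive n (M : 'M[R]_n) : posform M ->
  exists2 c, 0 < c & forall x, c * quad 1%:M x <= quad M x.
Proof.
move=> pM; pose S := M + M^T.
have qS x : quad S x = 2 * quad M x.
  by rewrite /S /quad bilDm bil_tr mulr_natl.
have pS : posform S by move=> x /pM; rewrite qS => h; rewrite mulr_gt0.
have uS := posform_unit pS.
have symS : S^T = S by rewrite /S linearD /= trmxK addrC.
pose q i := invmx S i i.
have key (x : 'cV_n) i : 0 < q i /\ x i 0 ^+ 2 <= q i * quad S x.
  pose y : 'cV[R]_n := invmx S *m delta_mx i 0.
  have Sy : S *m y = delta_mx i 0 by rewrite /y mulKVmx.
  have bilS z : bil S z y = z i 0.
    rewrite /bil -mulmxA Sy mxE (bigD1 i) //= big1 => [|j jNi].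
      by rewrite !mxE !eqxx mulr1 addr0.
    by rewrite !mxE (negPf jNi) mulr0.
  have yi : y i 0 = q i.
    rewrite mxE (bigD1 i) //= big1 => [|j jNi].
      by rewrite !mxE !eqxx mulr1 addr0.
    by rewrite !mxE (negPf jNi) mulr0.
  have y0 : y != 0.
    apply: contraTneq (oner_neq0 R) => y0.
    have /matrixP/(_ i 0) := Sy; rewrite y0 mulmx0 !mxE !eqxx /=.
    by move/eqP; rewrite eq_sym negbK.
  have q0 : 0 < q i by have := pS _ y0; rewrite /quad bilS yi.
  split=> //; set t := x i 0.
  (* The [S]-orthogonal projection of [x] onto [y] is subtracted; nonnegativity of the form at the
     remainder is Cauchy-Schwarz. *)
  have : 0 <= quad S (x - (t / q i) *: y).
    have [->|h] := eqVneq (x - (t / q i) *: y) 0; first by rewrite /quad bil0l.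
    by rewrite ltW ?pS.
  rewrite /quad bilDl !bilDr !bilNl !bilNr !bilZl !bilZr.
  rewrite -[bil S y x]bil_tr symS !bilS yi -/t divfK ?gt_eqF // opprK addrA subrK.
  rewrite subr_ge0 => h; rewrite mulrC -ler_pdivrMr //.
  by apply: le_trans h; rewrite expr2 mulrAC.
(* The factor 2 comes from [quad S x = 2 * quad M x]; the summand 1 keeps the denominator positive
   when [n = 0]. *)
exists ((1 + 2 * \sum_i q i)^-1) => [|x].
  rewrite invr_gt0 ltr_pwDl // mulr_ge0 //; apply: sumr_ge0 => i _.
  by have [/ltW] := key 0 i.
have qs0 : 0 <= \sum_i q i.
  by apply: sumr_ge0 => i _; have [/ltW] := key 0 i.
have qM0 : 0 <= quad M x.
  have [->|/pM/ltW//] := eqVneq x 0; by rewrite /quad bil0l.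
rewrite mulrC ler_pdivrMr; last by rewrite ltr_pwDl // mulr_ge0.
rewrite quad1E; apply: (@le_trans _ _ (\sum_i q i * quad S x)).
  by apply: ler_sum => i _; case: (key x i).
rewrite -mulr_suml qS; nra.
Qed.

Lemma quad_bounded n (M : 'M[R]_n) :
  exists2 C, 0 <= C & forall x, `|quad M x| <= C * quad 1%:M x.
Proof.
exists (\sum_i \sum_j `|M i j|) => [|x].
  by apply: sumr_ge0 => i _; apply: sumr_ge0 => j _.
have -> : quad M x = \sum_i \sum_j M i j * (x i 0 * x j 0).
  rewrite /quad /bil -mulmxA mxE; apply: eq_bigr => i _.
  rewrite !mxE big_distrr; apply: eq_bigr => j _ /=; ring.
rewrite mulr_suml; apply: le_trans (ler_norm_sum _ _ _) _.
apply: ler_sum => i _; rewrite mulr_suml.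
apply: le_trans (ler_norm_sum _ _ _) _; apply: ler_sum => j _.
rewrite normrM; apply: ler_wpM2l => //.
have := sqr_coord_le x i; have := sqr_coord_le x j.
by rewrite ler_norml => h1 h2; apply/andP; split; nra.
Qed.

Lemma finsler n p (Q : 'M[R]_p) (T : 'M[R]_(p, n)) (H : 'M[R]_n) :
  posform Q -> (forall x, x != 0 -> T *m x = 0 -> 0 < quad H x) ->
  exists2 e0, 0 < e0 &
    forall e, 0 < e <= e0 -> posform (T^T *m Q *m T + e *: H).
Proof.
move=> pQ hH; have [c1 c1_gt0 hc1] := posform_coercive pQ.
(* Since [T *m G *m T = T], [Pi] is a projection onto the kernel of [T]. *)
pose G := pinvmx T; pose Pi := 1%:M - G *m T.
have TPi : T *m Pi = 0.
  by rewrite mulmxBr mulmx1 mulmxA mulmxKpV ?subrr // submx_refl.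
have Pi_id x : T *m x = 0 -> Pi *m x = x.
  by move=> Tx; rewrite mulmxBl mul1mx -mulmxA Tx mulmx0 subr0.
have quadH_ge0 x : T *m x = 0 -> 0 <= quad H x.
  have [->|x0 /(hH _ x0)/ltW//] := eqVneq x 0; by rewrite /quad bil0l.
(* [H] is positive on the kernel only. Composing it with [Pi] and adding the squared norm of
   [T *m x] gives a form positive everywhere, whose coercivity constant [c2] then serves for [H] on
   the kernel. *)
have pN : posform (Pi^T *m H *m Pi + T^T *m 1%:M *m T).
  move=> x x0; rewrite /quad bilDm -!/(quad _ _) !quad_congr.
  have [Tx|Tx] := eqVneq (T *m x) 0.
    by rewrite (Pi_id _ _ Tx) Tx /quad bil0l addr0; apply: hH.
  apply: ltr_wpDl; last exact: quad1_gt0.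
  by apply: quadH_ge0; rewrite mulmxA TPi mul0mx.
have [c2 c2_gt0 hc2] := posform_coercive pN.
pose K := (H + H^T) *m G; pose L := G^T *m H *m G.
(* [C] bounds the terms in [t] that remain once the cross term [bil K u t] has been absorbed by
   completing the square. *)
have [C C_ge0 hC] := quad_bounded ((2 * c2)^-1 *: (K^T *m 1%:M *m K) - L).
have lower x : c2 / 2 * quad 1%:M (Pi *m x) - C * quad 1%:M (T *m x) <= quad H x.
  set u := Pi *m x; set t := T *m x.
  have Tu : T *m u = 0 by rewrite mulmxA TPi mul0mx.
  have xE : x = u + G *m t by rewrite /u mulmxBl mul1mx -mulmxA subrK.
  have -> : quad H x = quad H u + bil K u t + quad L t.
    rewrite /L /K quad_congr {1}xE /quad bilDl !bilDr bilMr bilDm bil_tr; ring.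
  have hu : c2 * quad 1%:M u <= quad H u.
    apply: le_trans (hc2 u) _; rewrite /quad bilDm -!/(quad _ _) !quad_congr.
    by rewrite Tu Pi_id // /quad bil0l addr0.
  (* This square, being nonnegative, bounds the cross term from below at the price of half of
     [c2 * quad 1%:M u]. *)
  have e : quad 1%:M (c2 *: u + K *m t)
      = c2 ^+ 2 * quad 1%:M u + 2 * c2 * bil K u t + quad 1%:M (K *m t).
    have sym : bil 1%:M (K *m t) u = bil K u t.
      by rewrite -bil_tr trmx1 -bilMr mul1mx.
    rewrite {1}/quad bilDl !bilDr !bilZl !bilZr sym -bilMr mul1mx -!/(quad _ _).
    by ring.
  have := quad1_ge0 (c2 *: u + K *m t); rewrite e => sq.
  have := hC t; rewrite {1}/quad bilDm bilZm bilNm -!/(quad _ _) quad_congr.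
  rewrite ler_norml => /andP[_ bnd].
  have cross : - (c2 / 2 * quad 1%:M u + (2 * c2)^-1 * quad 1%:M (K *m t))
      <= bil K u t.
    rewrite -(ler_pM2l (_ : 0 < 2 * c2)) ?mulr_gt0 // mulrN mulrDr.
    rewrite mulVKf ?gt_eqF ?mulr_gt0 //.
    have -> : 2 * c2 * (c2 / 2 * quad 1%:M u) = c2 ^+ 2 * quad 1%:M u by field.
    lra.
  lra.
(* This choice gives [e * C <= c1 / 2], so that half of the coercivity of [Q] survives; [C + 1]
   avoids a division by zero. *)
exists (c1 / (2 * (C + 1))) => [|e /andP[e_gt0 e_le] x x0].
  by rewrite divr_gt0 // mulr_gt0 // ltr_wpDl.
rewrite /quad bilDm bilZm -!/(quad _ _) quad_congr.
have := hc1 (T *m x); have := ler_wpM2l (ltW e_gt0) (lower x).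
have t0 := quad1_ge0 (T *m x); have u0 := quad1_ge0 (Pi *m x).
have eC : e * C <= c1 / 2.
  move: e_le; rewrite ler_pdivlMr; last by rewrite mulr_gt0 // ltr_wpDl.
  by have := mulr_ge0 (ltW e_gt0) C_ge0; nra.
have tC := ler_wpM2r t0 eC.
have [Tx|Tx] := eqVneq (T *m x) 0; last first.
  have := quad1_gt0 Tx; have := mulr_ge0 (ltW e_gt0) (mulr_ge0 (ltW c2_gt0) u0).
  nra.
have := quad1_gt0 (x := Pi *m x); rewrite Pi_id // => /(_ x0) xx.
have := mulr_gt0 e_gt0 (mulr_gt0 c2_gt0 xx).
rewrite Tx /quad !bil0l -!/(quad _ _); nra.
Qed.

End QuadraticForms.

(** * Symmetric definite matrices and antidiagonal multipliers *)

Section Definiteness.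
Variable R : realType.
Implicit Types (n m p : nat).

Lemma symmxP n (M : 'M[R]_n) : reflect (M^T = M) (M \is symmetricmx).
Proof.
rewrite is_hermitianmxE expr0 scale1r map_mx_id // eq_sym.
exact: eqP.
Qed.

Lemma posdefP n (M : 'M[R]_n) : posdef M <-> M^T = M /\ posform M.
Proof. by split=> -[/symmxP sM pM]; split=> //; apply/symmxP. Qed.

Lemma negdefP n (M : 'M[R]_n) : negdef M <-> M^T = M /\ posform (- M).
Proof.
split=> -[sM pM]; split; try exact/symmxP.
  by move=> x x0; rewrite /quad bilNm oppr_gt0; apply: pM.
by move=> x /pM; rewrite /quad bilNm oppr_gt0.
Qed.

Lemma congr_sym n p (T : 'M[R]_(n, p)) M :
  M^T = M -> (T^T *m M *m T)^T = T^T *m M *m T.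
Proof. by move=> sM; rewrite !trmx_mul trmxK sM mulmxA. Qed.

Lemma antidiag_sym n (P : 'M[R]_n) : P^T = P -> (antidiag P)^T = antidiag P.
Proof. by move=> sP; rewrite tr_block_mx !trmx0 sP. Qed.

Lemma posform_ulsub n p (M : 'M[R]_(n + p)) : posform M -> posform (ulsubmx M).
Proof.
move=> pM x x0; have := pM (col_mx x 0).
rewrite -{1}(submxK M) /quad bil_block bil0r !bil0l !addr0; apply.
by apply: contra x0; rewrite col_mx_eq0 => /andP[].
Qed.

Lemma quad_antidiag n (P : 'M[R]_n) a b : P^T = P ->
  quad (antidiag P) (col_mx a b) = 2 * bil P a b.
Proof.
move=> sP; rewrite /quad bil_block !bil0m -(bil_tr P a b) sP; ring.
Qed.

End Definiteness.

(** * Primal, dual and closed-loop scalings as Lyapunov conditions *)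

Section Scalings.
Variables (R : realType) (r s : nat).
Implicit Types (X : 'M[R]_(r + s)) (Delta : 'M[R]_(r, s)).

(* [N] has the eigenspaces spanned by S1 (eigenvalue -1) and S2 (eigenvalue 1),
   which makes the Lyapunov form of [N] block diagonal in these coordinates. *)
Lemma lyapunov_split (S1 : 'M[R]_(r + s, r)) (S2 : 'M[R]_(r + s, s)) N X :
    row_mx S1 S2 \in unitmx -> N *m S1 = - S1 -> N *m S2 = S2 -> X^T = X ->
  posform (X *m N) <-> negdef (S1^T *m X *m S1) /\ posdef (S2^T *m X *m S2).
Proof.
move=> uS NS1 NS2 sX.
(* The mixed terms in [a] and [b] cancel because [X] is symmetric and the eigenvalues are
   opposite. *)
have key a b : quad (X *m N) (row_mx S1 S2 *m col_mx a b)
    = quad (S2^T *m X *m S2) b - quad (S1^T *m X *m S1) a.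
  rewrite !quad_congr /quad bilMr mul_row_col mulmxDr !mulmxA NS1 NS2 mulNmx.
  rewrite !bilDl !bilDr !bilNr -[bil X (S2 *m b) (S1 *m a)]bil_tr sX; ring.
rewrite negdefP posdefP; split=> [pX|[[_ p1] [_ p2]]].
  split; split; try exact: congr_sym.
    move=> a a0; have := pX (row_mx S1 S2 *m col_mx a 0).
    rewrite key /quad bil0l sub0r bilNm; apply; apply: unitmx_inj => //.
    by apply: contra a0; rewrite col_mx_eq0 => /andP[].
  move=> b b0; have := pX (row_mx S1 S2 *m col_mx 0 b).
  rewrite key /quad bil0l subr0; apply; apply: unitmx_inj => //.
  by apply: contra b0; rewrite col_mx_eq0 => /andP[].
move=> x x0; rewrite -(mulKVmx uS x) -(vsubmxK (invmx _ *m x)) key.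
set a := usubmx _; set b := dsubmx _.
have : (a != 0) || (b != 0).
  rewrite -negb_and -col_mx_eq0 vsubmxK; apply: unitmx_inj => //.
  by rewrite unitmx_inv.
have h1 : 0 <= - quad (S1^T *m X *m S1) a.
  have [->|/p1/ltW] := eqVneq a 0; first by rewrite /quad bil0l oppr0.
  by rewrite /quad bilNm.
have h2 : 0 <= quad (S2^T *m X *m S2) b.
  by have [->|/p2/ltW//] := eqVneq b 0; rewrite /quad bil0l.
case/orP=> [/p1|/p2]; rewrite /quad ?bilNm -/(quad _ _) => h.
  by rewrite ltr_wpDl.
by rewrite ltr_pwDl.
Qed.

(** [lyapunov_split] applies with the images of [(I; 0)] and [(Delta; I)]. Negativity on the first
    does not mention [Delta]; in the converse it is read off at one member [D0] of [V]. *)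
Lemma primal_scalingP (V : 'M[R]_(r, s) -> Prop) X : (exists Delta, V Delta) ->
  primal_scaling V X <->
  X^T = X /\ forall Delta, V Delta -> posform (X *m lift_Delta Delta).
Proof.
move=> [D0 VD0].
have split_ Delta : X^T = X -> posform (X *m lift_Delta Delta) <->
    negdef ((col_mx 1%:M 0)^T *m X *m (col_mx 1%:M 0 : 'M_(r + s, r))) /\
    posdef ((col_mx Delta 1%:M)^T *m X *m col_mx Delta 1%:M).
  apply: lyapunov_split.
  - rewrite -block_mxEh unitmxE det_ublock !det1 mulr1; exact: unitr1.
  - by rewrite mul_block_col !mulmx0 mulmx1 !addr0 mul0mx opp_col_mx oppr0.
  - by rewrite mul_block_col !mulmx1 mulNmx mul1mx mul0mx add0r scaler_nat
      mulr2n addKr.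
split=> [[/symmxP sX n1 n2]|[sX pX]].
  by split=> // Delta VD; apply/split_ => //; split=> //; apply: n2.
split; first exact/symmxP.
  by have /split_[] := pX _ VD0.
by move=> Delta VD; have /split_[] := pX _ VD.
Qed.

(** The transposed lifted block has eigenvalue -1 on the image of [(I; - Delta^T)] and 1 on that of
    [(0; I)]. Now the negative condition varies with [Delta] and the positive one is read off at
    [D0]. *)
Lemma dual_scalingP (V : 'M[R]_(r, s) -> Prop) X : (exists Delta, V Delta) ->
  dual_scaling V X <->
  X^T = X /\ forall Delta, V Delta -> posform (X *m (lift_Delta Delta)^T).
Proof.
move=> [D0 VD0].
have split_ Delta : X^T = X -> posform (X *m (lift_Delta Delta)^T) <->
    negdef ((col_mx 1%:M (- Delta^T))^T *m X *m col_mx 1%:M (- Delta^T)) /\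
    posdef ((col_mx 0 1%:M)^T *m X *m (col_mx 0 1%:M : 'M_(r + s, s))).
  apply: lyapunov_split.
  - rewrite -block_mxEh unitmxE det_lblock !det1 mulr1; exact: unitr1.
  - rewrite tr_block_mx mul_block_col trmx0 !mul0mx !trmx1 linearN /= trmx1 !mulmx1.
    rewrite addr0 mul1mx opp_col_mx opprK linearZ /= scaler_nat mulr2n.
    by rewrite addrK.
  - by rewrite tr_block_mx mul_block_col !mulmx0 !mulmx1 trmx0 trmx1 !add0r.
split=> [[/symmxP sX n1 n2]|[sX pX]].
  by split=> // Delta VD; apply/split_ => //; split=> //; apply: n2.
split; first exact/symmxP.
  by have /split_[] := pX _ VD0.
by move=> Delta VD; have /split_[] := pX _ VD.
Qed.

(** The form of the antidiagonal multiplier is twice that of [P *m closed_loop_Delta K Delta]. *)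
Lemma closed_loop_scalingP nc lc m k (V : 'M[R]_(r, s) -> Prop)
    (K : controller R r s nc lc lc m k) P :
  closed_loop_scaling V K P <->
  P^T = P /\ forall Delta, V Delta -> posform (P *m closed_loop_Delta K Delta).
Proof.
have E Delta x : P^T = P -> quad ((col_mx (closed_loop_Delta K Delta) 1%:M)^T
     *m antidiag P *m col_mx (closed_loop_Delta K Delta) 1%:M) x
   = 2 * quad (P *m closed_loop_Delta K Delta) x.
  move=> sP; rewrite quad_congr mul_col_mx mul1mx quad_antidiag //.
  by rewrite -bil_tr sP /quad bilMr.
split=> -[sP pP]; split.
- exact/symmxP.
- move=> Delta /pP /posdefP[_ p] x /p.
  by rewrite E ?pmulr_rgt0 //; apply/symmxP.
- exact/symmxP.
- move=> Delta /pP p; apply/posdefP; split; first exact/congr_sym/antidiag_sym.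
  by move=> x /p; rewrite E // pmulr_rgt0.
Qed.

End Scalings.

(** * The two performance inequalities as quadratic forms, and their congruences *)

Section PerformanceForms.
Variable R : realType.
Implicit Types (x w q p : nat) (gamma : R).

(** A nonsymmetric representative of half the first inequality, whence [gamma / 2]. Each system
    matrix occurs in one block only, multiplied once from the left. *)
Definition form1 x w q p (S : perf_sys R x w q p) (X : 'M[R]_x) (P : 'M[R]_w)
    gamma : 'M[R]_((x + w) + q) :=
  block_mx (block_mx (X *m sA11 S) (X *m sA12 S) (P *m sA21 S) (P *m sA22 S))
           (col_mx (X *m sB1 S) (P *m sB2 S)) 0 (- (gamma / 2)%:M).

(** Represents the second inequality at full scale: the mixed terms are gathered in the lower row,
    whence the factors 2. *)
Definition form2 x w q p (S : perf_sys R x w q p) (U : 'M[R]_x) (P : 'M[R]_w)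
    (Z : 'M[R]_p) : 'M[R]_(x + w) :=
  block_mx U 0 (2 *: (P *m sA21 S)) (2 *: (P *m sA22 S))
  + (row_mx (sC1 S) (sC2 S))^T *m invmx Z *m row_mx (sC1 S) (sC2 S).

Lemma block_diag_sym n1 n2 (A : 'M[R]_n1) (B : 'M[R]_n2) :
  A^T = A -> B^T = B -> (block_mx A 0 0 B)^T = block_mx A 0 0 B.
Proof. by move=> sA sB; rewrite tr_block_mx !trmx0 sA sB. Qed.

Lemma bil_sym n (M : 'M[R]_n) a b : M^T = M -> bil M a b = bil M b a.
Proof. by move=> sM; rewrite -bil_tr sM. Qed.

Lemma lmi1P x w q p (S : perf_sys R x w q p) X P gamma :
  X^T = X -> P^T = P ->
  negdef ((outer1 S)^T *m middle1 q X P gamma *m outer1 S)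
  <-> posform (- form1 S X P gamma).
Proof.
move=> sX sP; rewrite negdefP.
have E v : quad ((outer1 S)^T *m middle1 q X P gamma *m outer1 S) v
    = 2 * quad (form1 S X P gamma) v.
  rewrite quad_congr -(vsubmxK v) -(vsubmxK (usubmx v)).
  move: (usubmx (usubmx v)) (dsubmx (usubmx v)) (dsubmx v) => a b c.
  rewrite /outer1 !mul_col_mx !mul_row_col !mul0mx !mul1mx !addr0 !add0r.
  rewrite /quad /middle1 !bil_block !bil0m (bil_sym _ a sX) (bil_sym _ b sP).
  rewrite !bilDr bil_col -!bilMr !bilNm.
  rewrite -(scalemx1 _ gamma) -(scalemx1 _ (gamma / 2)) !bilZm.
  by field.
split=> [[_ h] v /h|h]; first by rewrite /quad !bilNm -!/(quad _ _) E; nra.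
split; last by move=> v /h; rewrite /quad !bilNm -!/(quad _ _) E; nra.
apply/congr_sym/block_diag_sym.
  exact/block_diag_sym/antidiag_sym/sP/antidiag_sym.
by rewrite linearN /= tr_scalar_mx.
Qed.

Lemma lmi2P x w q p (S : perf_sys R x w q p) U P Z :
  U^T = U -> P^T = P -> Z^T = Z ->
  negdef ((outer2 S)^T *m middle2 U P Z *m outer2 S)
  <-> posform (- form2 S U P Z).
Proof.
move=> sU sP sZ; rewrite negdefP.
have E v : quad ((outer2 S)^T *m middle2 U P Z *m outer2 S) v
    = quad (form2 S U P Z) v.
  rewrite quad_congr -(vsubmxK v).
  move: (usubmx v) (dsubmx v) => a b.
  rewrite /outer2 !mul_col_mx !mul_row_col !mul0mx !mul1mx !addr0 !add0r.
  rewrite /form2 [RHS]bilDm -!/(quad _ _) quad_congr mul_row_col.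
  rewrite /quad /middle2 !bil_block !bil0m !bilZm (bil_sym _ b sP) !bilDr.
  by rewrite -!bilMr; ring.
split=> [[_ h] v /h|h]; first by rewrite /quad !bilNm -!/(quad _ _) E.
split; last by move=> v /h; rewrite /quad !bilNm -!/(quad _ _) E.
apply/congr_sym/block_diag_sym; first exact/block_diag_sym/antidiag_sym.
by rewrite trmx_inv sZ.
Qed.

Definition transf_sys x w x' w' q p (L1 : 'M[R]_(x', x)) (L2 : 'M[R]_(w', w))
    (T1 : 'M[R]_(x, x')) (T2 : 'M[R]_(w, w')) (S : perf_sys R x w q p) :
    perf_sys R x' w' q p :=
  {| sA11 := L1 *m sA11 S *m T1; sA12 := L1 *m sA12 S *m T2; sB1 := L1 *m sB1 S;
     sA21 := L2 *m sA21 S *m T1; sA22 := L2 *m sA22 S *m T2; sB2 := L2 *m sB2 S;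
     sC1 := sC1 S *m T1; sC2 := sC2 S *m T2; sD := sD S |}.

(** Taking [T1^T *m X] and [T2^T *m P] as left factors moves the certificates into the system and
    leaves identities in their place, as the design inequalities require. *)
Lemma form1_transf x w x' w' q p (T1 : 'M[R]_(x, x')) (T2 : 'M[R]_(w, w'))
    (S : perf_sys R x w q p) X P gamma :
  let T := block_mx (block_mx T1 0 0 T2) 0 0 1%:M in
  form1 (transf_sys (T1^T *m X) (T2^T *m P) T1 T2 S) 1%:M 1%:M gamma
  = T^T *m form1 S X P gamma *m T.
Proof.
rewrite /form1 /= !tr_block_mx !trmx0 trmx1 !mulmx_block.
rewrite ?(mul0mx, mulmx0, addr0, add0r, mul1mx, mulmx1) !mulmx_block mul_block_col.
by rewrite ?(mul0mx, mulmx0, addr0, add0r, mulmxA).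
Qed.

(** [U] multiplies no system matrix, so it undergoes the congruence itself; this is how the coupling
    matrix of [X1] and [Y1] arises. *)
Lemma form2_transf x w x' w' q p (T1 : 'M[R]_(x, x')) (T2 : 'M[R]_(w, w'))
    (S : perf_sys R x w q p) L1 U P Z :
  let T := block_mx T1 0 0 T2 in
  form2 (transf_sys L1 (T2^T *m P) T1 T2 S) (T1^T *m U *m T1) 1%:M Z
  = T^T *m form2 S U P Z *m T.
Proof.
rewrite /form2 /= mulmxDr mulmxDl; congr (_ + _).
  rewrite !tr_block_mx !trmx0 !mulmx_block.
  rewrite ?(mul0mx, mulmx0, addr0, add0r, mul1mx, mulmx1, mulmxA).
  by rewrite -!scalemxAr -!scalemxAl !mulmxA.
have -> : row_mx (sC1 S *m T1) (sC2 S *m T2)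
    = row_mx (sC1 S) (sC2 S) *m block_mx T1 0 0 T2.
  by rewrite mul_row_block !mulmx0 addr0 add0r.
by rewrite trmx_mul !mulmxA.
Qed.

Lemma transf_inj x w x' w' q (T1 : 'M[R]_(x, x')) (T2 : 'M[R]_(w, w')) v :
  block_mx (block_mx T1 0 0 T2) 0 0 (1%:M : 'M[R]_q) *m v = 0 :> 'cV_ _ ->
  [/\ T1 *m usubmx (usubmx v) = 0, T2 *m dsubmx (usubmx v) = 0 & dsubmx v = 0].
Proof.
rewrite -{1}(vsubmxK v) -{1}(vsubmxK (usubmx v)) !mul_block_col !mul0mx mul1mx.
rewrite !addr0 !add0r => /eqP; rewrite !col_mx_eq0.
by move=> /andP[/andP[/eqP ? /eqP ?] /eqP ?].
Qed.

End PerformanceForms.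

(** * The linearizing change of controller parameters and its inversion *)

Section ClosedLoopToDesign.
Variable R : realType.

Lemma closed_loop_blockE a b ac bc mp kp m k
    (A : 'M[R]_(a, b)) (Bp : 'M[R]_(a, mp)) (B : 'M[R]_(a, m))
    (Cp : 'M[R]_(kp, b)) (C : 'M[R]_(k, b))
    (Dp : 'M[R]_(kp, mp)) (E : 'M[R]_(kp, m)) (F : 'M[R]_(k, mp))
    (Ac : 'M[R]_(ac, bc)) (Bc : 'M[R]_(ac, k))
    (Cc : 'M[R]_(m, bc)) (Dc : 'M[R]_(m, k)) :
  closed_loop_block A Bp B Cp C Dp E F Ac Bc Cc Dc =
  block_mx (block_mx (A + B *m Dc *m C) (B *m Cc) (Bc *m C) Ac)
           (col_mx (Bp + B *m Dc *m F) (Bc *m F))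
           (row_mx (Cp + E *m Dc *m C) (E *m Cc)) (Dp + E *m Dc *m F).
Proof.
rewrite /closed_loop_block mul_col_mx mul_col_row !mulmx_block !mul_row_block.
rewrite !mul_block_col !mul_row_col.
rewrite ?(mul0mx, mulmx0, addr0, add0r, mul1mx, mulmx1).
rewrite add_block_mx add_block_mx add_col_mx add_row_mx.
by rewrite ?(mul0mx, mulmx0, addr0, add0r, mul1mx, mulmx1).
Qed.

Lemma design_blockE a b mp kp m k
    (A : 'M[R]_(a, b)) (Bp : 'M[R]_(a, mp)) (B : 'M[R]_(a, m))
    (Cp : 'M[R]_(kp, b)) (C : 'M[R]_(k, b))
    (Dp : 'M[R]_(kp, mp)) (E : 'M[R]_(kp, m)) (F : 'M[R]_(k, mp))
    (X : 'M[R]_(a, a)) (Y : 'M[R]_(b, b))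
    (K : 'M[R]_(a, b)) (L : 'M[R]_(a, k))
    (M : 'M[R]_(m, b)) (N : 'M[R]_(m, k)) :
  design_block A Bp B Cp C Dp E F X Y K L M N =
  block_mx (block_mx (A *m Y + B *m M) (A + B *m N *m C) K (X^T *m A + L *m C))
           (col_mx (Bp + B *m N *m F) (X^T *m Bp + L *m F))
           (row_mx (Cp *m Y + E *m M) (Cp + E *m N *m C)) (Dp + E *m N *m F).
Proof.
rewrite /design_block mul_col_mx mul_col_row !mulmx_block !mul_row_block.
rewrite !mul_block_col !mul_row_col.
rewrite ?(mul0mx, mulmx0, addr0, add0r, mul1mx, mulmx1).
rewrite add_block_mx add_block_mx add_col_mx add_row_mx.
by rewrite ?(mul0mx, mulmx0, addr0, add0r, mul1mx, mulmx1).
Qed.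

(** This is [R^T *m M] for a symmetric invertible [M] with first block row [(X, U)], where [R] is
    the [right_factor] built from the first block column of its inverse. Written out, it lets the
    block identities avoid inverses. *)
Definition left_factor a ac (X : 'M[R]_a) (U : 'M[R]_(a, ac)) :
  'M[R]_(a + a, a + ac) := block_mx 1%:M 0 X U.

Definition right_factor b bc (Y : 'M[R]_b) (W : 'M[R]_(bc, b)) :
  'M[R]_(b + bc, b + b) := block_mx Y 1%:M W 0.

(** The lower left block of the transformed closed-loop matrix, the only one nonlinear in
    certificates and controller together once [to_L], [to_M] and the feedthrough are taken as
    variables. *)
Definition to_K a b ac bc m k (A : 'M[R]_(a, b)) (B : 'M[R]_(a, m)) (C : 'M[R]_(k, b))
    (X : 'M[R]_a) (U : 'M[R]_(a, ac)) (Y : 'M[R]_b) (W : 'M[R]_(bc, b))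
    (Ac : 'M[R]_(ac, bc)) (Bc : 'M[R]_(ac, k)) (Cc : 'M[R]_(m, bc))
    (Dc : 'M[R]_(m, k)) :=
  X *m (A + B *m Dc *m C) *m Y + X *m B *m Cc *m W + U *m Bc *m C *m Y
  + U *m Ac *m W.

Definition to_L a ac m k (B : 'M[R]_(a, m)) (X : 'M[R]_a) (U : 'M[R]_(a, ac))
    (Bc : 'M[R]_(ac, k)) (Dc : 'M[R]_(m, k)) := X *m B *m Dc + U *m Bc.

Definition to_M b bc m k (C : 'M[R]_(k, b)) (Y : 'M[R]_b) (W : 'M[R]_(bc, b))
    (Cc : 'M[R]_(m, bc)) (Dc : 'M[R]_(m, k)) := Dc *m C *m Y + Cc *m W.

Lemma design_of_closed_loop_block a b ac bc mp kp m k
    (A : 'M[R]_(a, b)) (Bp : 'M[R]_(a, mp)) (B : 'M[R]_(a, m))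
    (Cp : 'M[R]_(kp, b)) (C : 'M[R]_(k, b))
    (Dp : 'M[R]_(kp, mp)) (E : 'M[R]_(kp, m)) (F : 'M[R]_(k, mp))
    (Ac : 'M[R]_(ac, bc)) (Bc : 'M[R]_(ac, k))
    (Cc : 'M[R]_(m, bc)) (Dc : 'M[R]_(m, k))
    (X : 'M[R]_a) (U : 'M[R]_(a, ac)) (Y : 'M[R]_b) (W : 'M[R]_(bc, b)) :
  X^T = X ->
  design_block A Bp B Cp C Dp E F X Y (to_K A B C X U Y W Ac Bc Cc Dc)
    (to_L B X U Bc Dc) (to_M C Y W Cc Dc) Dc
  = let S := closed_loop_block A Bp B Cp C Dp E F Ac Bc Cc Dc in
    block_mx (left_factor X U *m ulsubmx S *m right_factor Y W)
             (left_factor X U *m ursubmx S)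
             (dlsubmx S *m right_factor Y W) (drsubmx S).
Proof.
move=> sX; rewrite design_blockE closed_loop_blockE sX /=.
rewrite block_mxKul block_mxKur block_mxKdl block_mxKdr.
rewrite /left_factor /right_factor !mulmx_block mul_block_col mul_row_block.
rewrite ?(mul0mx, mulmx0, addr0, add0r, mul1mx, mulmx1).
rewrite /to_K /to_L /to_M ?(mulmxDl, mulmxDr, mulmxA) ?addrA.
congr (block_mx (block_mx _ _ _ _) _ _ _).
by rewrite -!addrA; congr (_ + (_ + _)); rewrite addrCA.
Qed.

Section Params.
Variables (r s n l mp kp m k nc lc : nat).
Variables (G : plant R n l l mp kp m k).
Variables (X1 : 'M[R]_n) (U1 : 'M[R]_(n, nc)) (Y1 : 'M[R]_n) (W1 : 'M[R]_(nc, n)).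
Variables (X2 : 'M[R]_l) (U2 : 'M[R]_(l, lc)) (Y2 : 'M[R]_l) (W2 : 'M[R]_(lc, l)).

Definition design_of_controller (K : controller R r s nc lc lc m k) :
    design_params R n l m k :=
  {| dK11 := to_K (pA11 G) (pB1 G) (pC1 G) X1 U1 Y1 W1 (kA11 K) (kB1 K) (kC1 K) (kD K);
     dK12 := to_K (pA12 G) (pB1 G) (pC2 G) X1 U1 Y2 W2 (kA12 K) (kB1 K) (kC2 K) (kD K);
     dL1 := to_L (pB1 G) X1 U1 (kB1 K) (kD K);
     dK21 := to_K (pA21 G) (pB2 G) (pC1 G) X2 U2 Y1 W1 (kA21 K) (kB2 K) (kC1 K) (kD K);
     dK22 := to_K (pA22 G) (pB2 G) (pC2 G) X2 U2 Y2 W2 (kA22 K) (kB2 K) (kC2 K) (kD K);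
     dL2 := to_L (pB2 G) X2 U2 (kB2 K) (kD K);
     dM1 := to_M (pC1 G) Y1 W1 (kC1 K) (kD K);
     dM2 := to_M (pC2 G) Y2 W2 (kC2 K) (kD K);
     dN := kD K |}.

Lemma design_sysE (K : controller R r s nc lc lc m k) : X1^T = X1 -> X2^T = X2 ->
  design_sys G X1 Y1 X2 Y2 (design_of_controller K)
  = transf_sys (left_factor X1 U1) (left_factor X2 U2)
      (right_factor Y1 W1) (right_factor Y2 W2) (closed_loop G K).
Proof.
move=> sX1 sX2; rewrite /design_sys /perf_sys_of !design_of_closed_loop_block //=.
by rewrite !(block_mxKul, block_mxKur, block_mxKdl, block_mxKdr).
Qed.

Definition controller_of_design (T : design_params R n l m k)
    (sch : 'M[R]_(r, s) -> 'M[R]_lc)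
    (U1i : 'M[R]_(nc, n)) (W1i : 'M[R]_(n, nc))
    (U2i : 'M[R]_(lc, l)) (W2i : 'M[R]_(l, lc)) :
    controller R r s nc lc lc m k :=
  let D := dN T in
  let B1 := U1i *m (dL1 T - X1 *m pB1 G *m D) in
  let B2 := U2i *m (dL2 T - X2 *m pB2 G *m D) in
  let C1 := (dM1 T - D *m pC1 G *m Y1) *m W1i in
  let C2 := (dM2 T - D *m pC2 G *m Y2) *m W2i in
  {| kA11 := U1i *m (dK11 T - to_K (pA11 G) (pB1 G) (pC1 G)
               X1 U1 Y1 W1 0 B1 C1 D) *m W1i;
     kA12 := U1i *m (dK12 T - to_K (pA12 G) (pB1 G) (pC2 G)
               X1 U1 Y2 W2 0 B1 C2 D) *m W2i;
     kB1 := B1;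
     kA21 := U2i *m (dK21 T - to_K (pA21 G) (pB2 G) (pC1 G)
               X2 U2 Y1 W1 0 B2 C1 D) *m W1i;
     kA22 := U2i *m (dK22 T - to_K (pA22 G) (pB2 G) (pC2 G)
               X2 U2 Y2 W2 0 B2 C2 D) *m W2i;
     kB2 := B2; kC1 := C1; kC2 := C2; kD := D; sched := sch |}.

(** The system is triangular: the feedthrough is [dN], then [dL] and [dM] fix the input and output
    matrices, and finally [dK] fixes the dynamics, which enter only as [U *m Ac *m W]. Right
    inverses of the [U] and left inverses of the [W] suffice. *)
Lemma design_of_controllerK T sch U1i W1i U2i W2i :
  U1 *m U1i = 1%:M -> W1i *m W1 = 1%:M -> U2 *m U2i = 1%:M -> W2i *m W2 = 1%:M ->
  design_of_controller (controller_of_design T sch U1i W1i U2i W2i) = T.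
Proof.
move=> hU1 hW1 hU2 hW2.
have solveK a b ac bc A B C X (U : 'M[R]_(a, ac)) Y (W : 'M[R]_(bc, b)) Bc Cc Dc
    Ui Wi (K : 'M[R]_(a, b)) : U *m Ui = 1%:M -> Wi *m W = 1%:M ->
    to_K (m := m) (k := k) A B C X U Y W
      (Ui *m (K - to_K A B C X U Y W 0 Bc Cc Dc) *m Wi) Bc Cc Dc = K.
  move=> hU hW; set K0 := to_K A B C X U Y W 0 Bc Cc Dc.
  have -> Ac : to_K A B C X U Y W Ac Bc Cc Dc = K0 + U *m Ac *m W.
    by rewrite /K0 /to_K mulmx0 mul0mx addr0.
  by rewrite !mulmxA hU mul1mx -mulmxA hW mulmx1 addrC subrK.
case: T => *; rewrite /design_of_controller /controller_of_design /= !solveK //.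
by rewrite /to_L /to_M; congr DesignParams;
  rewrite ?mulmxA ?(hU1, hU2) -?mulmxA ?(hW1, hW2) ?mul1mx ?mulmx1 !mulmxA addrC subrK.
Qed.

End Params.
End ClosedLoopToDesign.

(** * Perturbation of the design inequalities *)

Section Perturbation.
Variables (R : realType) (n l mp kp m k : nat) (G : plant R n l l mp kp m k).

Definition perturb_design (T : design_params R n l m k) (J1 : 'M[R]_n) (J2 : 'M[R]_l) :=
  {| dK11 := dK11 T + J1; dK12 := dK12 T; dL1 := dL1 T;
     dK21 := dK21 T; dK22 := dK22 T + J2; dL2 := dL2 T;
     dM1 := dM1 T; dM2 := dM2 T; dN := dN T |}.

(** The dependence on [e] is exactly affine, as required by [finsler]. The weights [a1], [a2] select
    the shifted matrix: [X1] for strictness in the necessity part, [X2] for regularity in the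
    sufficiency part. *)
Lemma form1_perturb X1 Y1 X2 Y2 T (a1 a2 : R) J1 J2 gamma e :
  form1 (design_sys G (X1 + (e * a1)%:M) Y1 (X2 + (e * a2)%:M) Y2
           (perturb_design T (e *: J1) (e *: J2))) 1%:M 1%:M gamma
  = form1 (design_sys G X1 Y1 X2 Y2 T) 1%:M 1%:M gamma
  + e *: block_mx
      (block_mx (block_mx 0 0 J1 (a1 *: pA11 G)) (block_mx 0 0 0 (a1 *: pA12 G))
                (block_mx 0 0 0 (a2 *: pA21 G)) (block_mx 0 0 J2 (a2 *: pA22 G)))
      (col_mx (col_mx 0 (a1 *: pBp1 G)) (col_mx 0 (a2 *: pBp2 G))) 0 0.
Proof.
rewrite /form1 /design_sys /= !design_blockE.
rewrite !(block_mxKul, block_mxKur, block_mxKdl, block_mxKdr) !mul1mx.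
rewrite !scale_block_mx !scale_col_mx !scaler0 !add_block_mx !add_col_mx !addr0.
rewrite !linearD /= !tr_scalar_mx !mulmxDl !mul_scalar_mx !scalerA.
congr block_mx; [congr block_mx|congr col_mx];
  first [congr block_mx|congr col_mx]; exact: addrAC.
Qed.

Lemma form2_perturb X1 Y1 X2 Y2 T (a1 a2 : R) J1 J2 Z e :
  form2 (design_sys G (X1 + (e * a1)%:M) Y1 (X2 + (e * a2)%:M) Y2
           (perturb_design T (e *: J1) (e *: J2)))
    (- block_mx Y1 1%:M 1%:M (X1 + (e * a1)%:M)) 1%:M Z
  = form2 (design_sys G X1 Y1 X2 Y2 T) (- block_mx Y1 1%:M 1%:M X1) 1%:M Z
  + e *: block_mx (block_mx 0 0 0 (- a1%:M)) 0
           (2 *: block_mx 0 0 0 (a2 *: pA21 G)) (2 *: block_mx 0 0 J2 (a2 *: pA22 G)).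
Proof.
rewrite /form2 /design_sys /= !design_blockE.
rewrite !(block_mxKul, block_mxKur, block_mxKdl, block_mxKdr) !mul1mx.
rewrite [RHS]addrAC; congr (_ + _).
rewrite !opp_block_mx !scale_block_mx !scaler0 !add_block_mx !addr0.
rewrite !linearD /= !tr_scalar_mx !mulmxDl !mul_scalar_mx.
congr block_mx; congr block_mx.
- by rewrite scalerN scale_scalar_mx.
- by rewrite scalerDr !scalerA mulrCA mulrA addrAC.
- by rewrite !scalerA mulrC.
- by rewrite scalerDr !scalerA mulrCA mulrA addrAC.
Qed.

End Perturbation.

(** * Block factors of a symmetric matrix and the kernel of the right factor *)

Section Factors.
Variable R : realType.

(** The first block row of [invmx M *m M = 1%:M] yields the row [(I, 0)]. *)
Lemma left_factorE a ac (M : 'M[R]_(a + ac)) : M \in unitmx -> M^T = M ->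
  left_factor (ulsubmx M) (ursubmx M)
  = (right_factor (ulsubmx (invmx M)) (dlsubmx (invmx M)))^T *m M.
Proof.
move=> uM sM; have sMi : (invmx M)^T = invmx M by rewrite trmx_inv sM.
rewrite /right_factor tr_block_mx !trmx0 trmx1 trmx_ulsub trmx_dlsub sMi.
move: (invmx M) (mulVmx uM) => Mi; rewrite -{1}(submxK Mi) -{1}(submxK M).
rewrite mulmx_block scalar_mx_block => /eq_block_mx[e1 e2 _ _].
by rewrite -{3}(submxK M) mulmx_block e1 e2 !mul1mx !mul0mx !addr0.
Qed.

Lemma left_right_factor a ac (M : 'M[R]_(a + ac)) : M \in unitmx ->
  left_factor (ulsubmx M) (ursubmx M)
    *m right_factor (ulsubmx (invmx M)) (dlsubmx (invmx M))
  = block_mx (ulsubmx (invmx M)) 1%:M 1%:M (ulsubmx M).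
Proof.
move=> uM; move: (invmx M) (mulmxV uM) => Mi.
rewrite -{1}(submxK Mi) -{1}(submxK M).
rewrite mulmx_block scalar_mx_block => /eq_block_mx[e1 _ _ _].
by rewrite mulmx_block e1 !mul1mx !mul0mx !mulmx0 !mulmx1 !addr0.
Qed.

Lemma right_factor_ker b bc (Y : 'M[R]_b) (W : 'M[R]_(bc, b)) (v : 'cV_(b + b)) :
  right_factor Y W *m v = 0 -> Y *m usubmx v = - dsubmx v.
Proof.
rewrite -{1}(vsubmxK v) mul_block_col mul1mx => /eqP.
by rewrite col_mx_eq0 => /andP[]; rewrite addr_eq0 => /eqP.
Qed.

Lemma right_factor_ker0 b bc (Y : 'M[R]_b) (W : 'M[R]_(bc, b)) (v : 'cV_(b + b)) :
  Y \in unitmx -> right_factor Y W *m v = 0 -> dsubmx v = 0 -> v = 0.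
Proof.
move=> uY /right_factor_ker e d0; rewrite -(vsubmxK v) d0.
move: e; rewrite d0 oppr0 => e.
by rewrite -(mulKmx uY (usubmx v)) e mulmx0 col_mx0.
Qed.

Lemma bil_right_factor_ker b bc (Y : 'M[R]_b) (W : 'M[R]_(bc, b)) (v : 'cV_(b + b)) :
  right_factor Y W *m v = 0 -> bil Y (dsubmx v) (usubmx v) = - quad 1%:M (dsubmx v).
Proof. by move=> /right_factor_ker e; rewrite -(mul1mx Y) bilMr e bilNr. Qed.

(** A kernel vector [(a; b)] satisfies [Y a = - b], so for invertible [Y] it is determined by
    [b]. *)
Lemma right_factor_ker_gt0 b bc (Y : 'M[R]_b) (W : 'M[R]_(bc, b)) (v : 'cV_(b + b)) :
  Y \in unitmx -> right_factor Y W *m v = 0 -> v != 0 -> 0 < quad 1%:M (dsubmx v).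
Proof.
move=> uY k v0; apply: quad1_gt0.
by apply: contra v0 => /eqP /(right_factor_ker0 uY k) ->.
Qed.

Lemma quad1_col n1 n2 (a : 'cV[R]_n1) (b : 'cV[R]_n2) :
  quad 1%:M (col_mx a b) = quad 1%:M a + quad 1%:M b.
Proof. by rewrite scalar_mx_block /quad bil_block !bil0m addr0 add0r. Qed.

End Factors.

(** * From the analysis inequalities to the design inequalities *)

Section Necessity.
Variables (R : realType) (n r s mp kp m k : nat).
Variables (V : 'M[R]_(r, s) -> Prop) (G : plant R n r s mp kp m k) (gamma : R).

(** The controller sizes are arbitrary, so the congruences may be singular and give only
    semidefinite inequalities. One perturbation, with a common [e], repairs both inequalities and
    the coupling condition; [X2] and [Y2] stay fixed and so remain scalings. *)
Lemma design_of_analysis nc lc (K : controller R r s nc lc lc m k) Xc P Z :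
  (exists Delta, V Delta) ->
  analysis_lmis V G gamma K Xc P Z ->
  exists (X1 Y1 : 'M[R]_n) (X2 Y2 : 'M[R]_(r + s))
    (T : design_params R n (r + s) m k), design_lmis V G gamma X1 Y1 X2 Y2 T Z.
Proof.
move=> V0 [/posdefP[sXc pXc] [pZ tZ] /closed_loop_scalingP[sP pP]].
set GL := lift_plant G; set S := closed_loop GL K.
have [D0 VD0] := V0.
have uXc := posform_unit pXc.
have uP : P \in unitmx.
  by have := posform_unit (pP _ VD0); rewrite unitmx_mul => /andP[].
have /posdefP[sZ _] := pZ.
have sZi : - Xc = (- Xc)^T by rewrite linearN /= sXc.
move=> /(lmi1P _ _ sXc sP) q1 /(lmi2P _ (esym sZi) sP sZ) q2.
have sXi : (invmx Xc)^T = invmx Xc by rewrite trmx_inv sXc.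
have sPi : (invmx P)^T = invmx P by rewrite trmx_inv sP.
set X1 := ulsubmx Xc; set X2 := ulsubmx P.
set Y1 := ulsubmx (invmx Xc); set Y2 := ulsubmx (invmx P).
set W1 := dlsubmx (invmx Xc); set W2 := dlsubmx (invmx P).
have sX1 : X1^T = X1 by rewrite trmx_ulsub sXc.
have sX2 : X2^T = X2 by rewrite trmx_ulsub sP.
have sY1 : Y1^T = Y1 by rewrite trmx_ulsub sXi.
have sY2 : Y2^T = Y2 by rewrite trmx_ulsub sPi.
have pX2 Delta : V Delta -> posform (X2 *m lift_Delta Delta).
  move=> /pP /posform_ulsub; rewrite -{1}(submxK P) /closed_loop_Delta.
  by rewrite mulmx_block block_mxKul mulmx0 addr0.
(* Dualization: congruence with [P] turns the inverse scaling times the transposed uncertainty into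
   the transpose of [P *m closed_loop_Delta K Delta]. *)
have pY2 Delta : V Delta -> posform (Y2 *m (lift_Delta Delta)^T).
  move=> VD; suff : posform (invmx P *m (closed_loop_Delta K Delta)^T).
    move/posform_ulsub; rewrite -{1}(submxK (invmx P)) tr_block_mx mulmx_block.
    by rewrite block_mxKul trmx0 mulmx0 addr0.
  apply: (posform_congrW uP); rewrite !mulmxA sP mulmxV // mul1mx.
  by rewrite -{1}sP -trmx_mul; apply/posform_tr/pP.
have uY1 : Y1 \in unitmx.
  apply/posform_unit/posform_ulsub/(posform_congrW uXc).
  by rewrite sXc mulmxV // mul1mx.
have uY2 : Y2 \in unitmx.
  by have := posform_unit (pY2 _ VD0); rewrite unitmx_mul => /andP[].
set T1 := right_factor Y1 W1; set T2 := right_factor Y2 W2.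
set T0 := design_of_controller GL X1 (ursubmx Xc) Y1 W1 X2 (ursubmx P) Y2 W2 K.
have SE : design_sys GL X1 Y1 X2 Y2 T0 = transf_sys (T1^T *m Xc) (T2^T *m P) T1 T2 S.
  by rewrite design_sysE // !left_factorE.
have XXE : block_mx Y1 1%:M 1%:M X1 = T1^T *m Xc *m T1.
  by rewrite -left_right_factor // left_factorE.
(* [T1] and [T2] need not be injective. On their kernels b_i = - Y_i a_i, so that
   mu Y_i added to K_ii contributes - mu |b_i|^2, which absorbs the indefinite terms
   produced by shifting X1. *)
have ker_gt0 v : T1 *m usubmx v = 0 -> T2 *m dsubmx v = 0 -> v != 0 ->
    0 < quad 1%:M (dsubmx (usubmx v)) + quad 1%:M (dsubmx (dsubmx v)).
  move=> k1 k2 v0; have [u0|u0] := eqVneq (usubmx v) 0; last first.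
    by rewrite ltr_pwDl ?quad1_ge0 // (right_factor_ker_gt0 uY1 k1).
  rewrite ltr_wpDl ?quad1_ge0 // (right_factor_ker_gt0 uY2 k2) //.
  by apply: contra v0 => /eqP d0; rewrite -(vsubmxK v) u0 d0 col_mx0.
(* On the kernels, shifting [X1] adds the terms of [A11] and [A12] in the b_i, bounded by [C]; the
   performance input vanishes there. With [mu = C + 1] the sum of the |b_i|^2 remains. *)
have [C C_ge0 hC] := quad_bounded (block_mx (pA11 GL) (pA12 GL) 0 0).
pose mu := C + 1.
have [e1 e1_gt0 he1] : exists2 e0, 0 < e0 & forall e, 0 < e <= e0 ->
    posform (- form1 (design_sys GL (X1 + (e * 1)%:M) Y1 (X2 + (e * 0)%:M) Y2
      (perturb_design T0 (e *: (mu *: Y1)) (e *: (mu *: Y2)))) 1%:M 1%:M gamma).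
  have [|e0 e0_gt0 he] := finsler (T := block_mx (block_mx T1 0 0 T2) 0 0 1%:M)
    (H := - block_mx
      (block_mx (block_mx 0 0 (mu *: Y1) (1 *: pA11 GL)) (block_mx 0 0 0 (1 *: pA12 GL))
                (block_mx 0 0 0 (0 *: pA21 GL)) (block_mx 0 0 (mu *: Y2) (0 *: pA22 GL)))
      (col_mx (col_mx 0 (1 *: pBp1 GL)) (col_mx 0 (0 *: pBp2 GL))) 0 0) q1.
    move=> v v0 /transf_inj[k1 k2 w0].
    have pos : 0 < quad 1%:M (dsubmx (usubmx (usubmx v)))
        + quad 1%:M (dsubmx (dsubmx (usubmx v))).
      apply: ker_gt0 => //; apply: contra v0 => /eqP u0.
      by rewrite -(vsubmxK v) w0 u0 col_mx0.
    have := bil_right_factor_ker k1; have := bil_right_factor_ker k2.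
    rewrite -(vsubmxK v) -(vsubmxK (usubmx v)) w0.
    rewrite -(vsubmxK (usubmx (usubmx v))) -(vsubmxK (dsubmx (usubmx v))).
    move: pos; set a1 := usubmx (usubmx (usubmx v)).
    set b1 := dsubmx (usubmx (usubmx v)).
    set a2 := usubmx (dsubmx (usubmx v)); set b2 := dsubmx (dsubmx (usubmx v)) => pos.
    rewrite !(col_mxKu, col_mxKd) => d2 d1.
    rewrite /quad bilNm !bil_block !bil_col !bil0m !bilZm !bil0r d1 d2.
    have := hC (col_mx b1 b2); rewrite quad1_col /quad !bil_block !bil0m.
    rewrite ler_norml => /andP[_]; move: pos; rewrite /quad /mu; lra.
  exists e0 => // e /he; rewrite mulmxN mulNmx.
  by rewrite form1_perturb SE form1_transf opprD scalerN.
(* On the kernels the shift of [X1] contributes |b_1|^2 and [mu *: Y2] contributes 2 mu |b_2|^2. *)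
have [e2 e2_gt0 he2] : exists2 e0, 0 < e0 & forall e, 0 < e <= e0 ->
    posform (- form2 (design_sys GL (X1 + (e * 1)%:M) Y1 (X2 + (e * 0)%:M) Y2
      (perturb_design T0 (e *: (mu *: Y1)) (e *: (mu *: Y2))))
      (- block_mx Y1 1%:M 1%:M (X1 + (e * 1)%:M)) 1%:M Z).
  have [|e0 e0_gt0 he] := finsler (T := block_mx T1 0 0 T2)
    (H := - block_mx (block_mx 0 0 0 (- 1%:M)) 0
           (2 *: block_mx 0 0 0 (0 *: pA21 GL))
           (2 *: block_mx 0 0 (mu *: Y2) (0 *: pA22 GL))) q2.
    move=> v v0 kv; have [k1 k2] : T1 *m usubmx v = 0 /\ T2 *m dsubmx v = 0.
      move: kv; rewrite -{1}(vsubmxK v) mul_block_col !mul0mx addr0 add0r => /eqP.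
      by rewrite col_mx_eq0 => /andP[/eqP ? /eqP ?].
    have pos := ker_gt0 _ k1 k2 v0.
    have := bil_right_factor_ker k1; have := bil_right_factor_ker k2.
    rewrite -(vsubmxK v) -(vsubmxK (usubmx v)) -(vsubmxK (dsubmx v)).
    move: pos; set a1 := usubmx (usubmx v); set b1 := dsubmx (usubmx v).
    set a2 := usubmx (dsubmx v); set b2 := dsubmx (dsubmx v) => pos.
    rewrite !(col_mxKu, col_mxKd) => d2 d1.
    rewrite /quad bilNm !bil_block !bil0m !bilZm !bil_block !bilNm !bilZm !bil0m d2.
    have := quad1_ge0 b2; have := mulr_ge0 C_ge0 (quad1_ge0 b2).
    by move: pos; rewrite /quad /mu; lra.
  exists e0 => // e /he; rewrite mulmxN mulNmx form2_perturb SE.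
  have -> : - block_mx Y1 1%:M 1%:M X1 = T1^T *m (- Xc) *m T1.
    by rewrite XXE mulmxN mulNmx.
  by rewrite form2_transf opprD scalerN.
have [e3 e3_gt0 he3] : exists2 e0, 0 < e0 & forall e, 0 < e <= e0 ->
    posform (block_mx Y1 1%:M 1%:M (X1 + (e * 1)%:M)).
  have [|e0 e0_gt0 he] := finsler (T := T1) (H := block_mx 0 0 0 1%:M) pXc.
    move=> v v0 k1; have d1 := right_factor_ker k1.
    rewrite -(vsubmxK v) /quad bil_block !bil0m !add0r; apply: quad1_gt0.
    by apply: contra v0 => /eqP /(right_factor_ker0 uY1 k1) ->.
  exists e0 => // e /he; rewrite -XXE scale_block_mx add_block_mx !scaler0 !addr0.
  by rewrite scale_scalar_mx.
pose e := Num.min e1 (Num.min e2 e3).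
have e_gt0 : 0 < e by rewrite !lt_min e1_gt0 e2_gt0.
exists (X1 + (e * 1)%:M), Y1, (X2 + (e * 0)%:M), Y2,
  (perturb_design T0 (e *: (mu *: Y1)) (e *: (mu *: Y2))).
have sX1e : (X1 + (e * 1)%:M)^T = X1 + (e * 1)%:M.
  by rewrite linearD /= tr_scalar_mx sX1.
have sXX : (block_mx Y1 1%:M 1%:M (X1 + (e * 1)%:M))^T
    = block_mx Y1 1%:M 1%:M (X1 + (e * 1)%:M).
  by rewrite tr_block_mx !trmx1 sX1e sY1.
split=> //; first by split; apply/symmxP.
- split; last by apply/dual_scalingP.
  by apply/primal_scalingP => //; rewrite mulr0 raddf0 addr0.
- by apply/posdefP; split=> //; apply: he3; rewrite e_gt0 !ge_min lexx !orbT.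
- split.
    by apply/lmi1P; rewrite ?trmx1 //; apply: he1; rewrite e_gt0 ge_min lexx.
  apply/lmi2P; rewrite ?trmx1 ?linearN /= ?sXX //; apply: he2.
  by rewrite e_gt0 !ge_min lexx !orbT.
Qed.

End Necessity.

(** * From the design inequalities to a controller with affine scheduling *)

Section Sufficiency.
Variable R : realType.

(** Finsler's lemma for the identity, whose kernel imposes no condition on [H]. *)
Lemma posform_open n (Q H : 'M[R]_n) : posform Q ->
  exists2 e0, 0 < e0 & forall e, 0 < e <= e0 -> posform (Q + e *: H).
Proof.
move=> pQ; have [x x0|e0 e0_gt0 he] := finsler (T := 1%:M) (H := H) pQ.
  by rewrite mul1mx => e; rewrite e eqxx in x0.
by exists e0 => // e /he; rewrite trmx1 mul1mx mulmx1.
Qed.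

(** [A + e%:M] is singular only when [e] is an eigenvalue of [- A]. The [size p] distinct candidates
    [e0 / (i + 1)] outnumber the possible roots of the characteristic polynomial [p]. *)
Lemma shift_unitmx n (A : 'M[R]_n) e0 : 0 < e0 ->
  exists2 e, 0 < e <= e0 & A + e%:M \in unitmx.
Proof.
move=> e0_gt0; set p := char_poly (- A).
have p0 : p != 0 by rewrite monic_neq0 // char_poly_monic.
pose rs := [seq e0 / i.+1%:R | i <- iota 0 (size p)].
have [allr|] := boolP (all (root p) rs).
  have : (size rs < size p)%N.
    apply: max_poly_roots => //; rewrite map_inj_uniq ?iota_uniq // => i j /eqP.
    rewrite -subr_eq0 -mulrBr mulf_eq0 gt_eqF //= subr_eq0 => /eqP /invr_inj /eqP.
    by rewrite eqr_nat eqSS => /eqP.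
  by rewrite size_map size_iota ltnn.
case/allPn => e /mapP[i _ ->] nr; exists (e0 / i.+1%:R).
  by rewrite divr_gt0 ?ltr0n //= ler_pdivrMr ?ltr0n // ler_peMr ?ler1n // ltW.
move: nr; rewrite -eigenvalue_root_char /eigenvalue /eigenspace negbK kermx_eq0.
by rewrite row_free_unit -opprD -scaleN1r unitmxZ // unitrN1.
Qed.

Lemma block_diag_unitmx n1 n2 (A : 'M[R]_n1) (B : 'M[R]_n2) :
  A \in unitmx -> B \in unitmx -> block_mx A 0 0 B \in unitmx.
Proof. by rewrite !unitmxE det_ublock unitrM => -> ->. Qed.

Lemma posform_skew_block n1 n2 (A : 'M[R]_n1) (B : 'M[R]_(n1, n2)) (D : 'M[R]_n2) :
  posform A -> posform D -> posform (block_mx A B (- B^T) D).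
Proof.
move=> pA pD x; rewrite -(vsubmxK x); move: (usubmx x) (dsubmx x) => a b.
rewrite col_mx_eq0 negb_and /quad bil_block bilNm bil_tr addrA addrK.
rewrite -!/(quad _ _) => h.
have hA : 0 <= quad A a.
  by have [->|/pA/ltW//] := eqVneq a 0; rewrite /quad bil0l.
have hD : 0 <= quad D b.
  by have [->|/pD/ltW//] := eqVneq b 0; rewrite /quad bil0l.
by case/orP: h => [/pA|/pD] h; [rewrite ltr_pwDl|rewrite ltr_wpDl].
Qed.

(** The Schur complement is the restriction of the block form to the vectors [(- Y^-1 x; x)]. *)
Lemma schur_posform n (X Y : 'M[R]_n) : Y^T = Y ->
  posform (block_mx Y 1%:M 1%:M X) -> posform (X - invmx Y).
Proof.
move=> sY pXX; have uY : Y \in unitmx.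
  by have := posform_unit (posform_ulsub pXX); rewrite block_mxKul.
have -> : X - invmx Y = (col_mx (- invmx Y) 1%:M)^T *m block_mx Y 1%:M 1%:M X
    *m col_mx (- invmx Y) 1%:M.
  rewrite -mulmxA mul_block_col mulmxN mulmxV // mulmx1 addNr mulmx1 mul1mx.
  by rewrite tr_col_mx mul_row_col mulmx0 add0r trmx1 mul1mx addrC.
apply: posform_congr => // x x0.
by rewrite mul_col_mx col_mx_eq0 mul1mx negb_and x0 orbT.
Qed.

(* The matrix with upper left block [X] whose inverse has upper left block [Y],
   both off-diagonal factors being taken symmetric. *)
Definition glue n (X Y : 'M[R]_n) : 'M[R]_(n + n) :=
  block_mx X (invmx Y - X) (invmx Y - X) (X - invmx Y).

Section Glue.
Variables (n : nat) (X Y : 'M[R]_n).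
Hypotheses (sX : X^T = X) (sY : Y^T = Y) (uY : Y \in unitmx).

Lemma glue_sym : (glue X Y)^T = glue X Y.
Proof. by rewrite tr_block_mx !linearB /= trmx_inv sX sY. Qed.

(** The analogue of [left_factorE] for [W = Y] and [U = Y^-1 - X], obtained by direct multiplication
    and hence free of the inverse of [glue X Y]. *)
Lemma glue_left_factor :
  left_factor X (invmx Y - X) = (right_factor Y Y)^T *m glue X Y.
Proof.
rewrite tr_block_mx sY trmx1 trmx0 mulmx_block !mul1mx !mul0mx !addr0.
by rewrite -!mulmxDr (addrC X) subrK mulmxV // -[X - _]opprB subrr mulmx0.
Qed.

Lemma glue_congr :
  (right_factor Y Y)^T *m glue X Y *m right_factor Y Y = block_mx Y 1%:M 1%:M X.
Proof.
rewrite -glue_left_factor mulmx_block !mul1mx !mul0mx !mulmx0 !mulmx1 !addr0.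
by rewrite -mulmxDl (addrC X) subrK mulVmx.
Qed.

Lemma right_factor_unitmx : right_factor Y Y \in unitmx.
Proof.
have : right_factor Y Y *m block_mx 0 (invmx Y) 1%:M (- 1%:M) = 1%:M.
  by rewrite mulmx_block !mulmx0 !mul0mx !add0r !addr0 mul1mx mulmxV // mul1mx
    subrr -scalar_mx_block.
by case/mulmx1_unit.
Qed.

End Glue.

Section Schedule.
Variables (r s : nat) (X Y : 'M[R]_(r + s)).

(* The value that makes the Lyapunov form of the closed-loop uncertainty block
   skew off the diagonal in the coordinates of [right_factor Y Y]. *)
Definition schedule (D : 'M[R]_(r + s)) : 'M[R]_(r + s) :=
  invmx (invmx Y - X) *m (- (D^T *m invmx Y + X *m D)).

Lemma schedule_linear : linear schedule.
Proof.
move=> a A B; rewrite /schedule linearP /= mulmxDl mulmxDr -scalemxAl -scalemxAr.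
by rewrite addrACA -scalerDr opprD -scalerN mulmxDr -scalemxAr.
Qed.

Lemma scheduleK D : invmx Y - X \in unitmx -> Y \in unitmx ->
  (invmx Y - X) *m schedule D *m Y = - (D^T + X *m D *m Y).
Proof.
by move=> uU uY; rewrite /schedule mulmxA mulmxV // mul1mx mulNmx mulmxDl mulmxKV.
Qed.

End Schedule.

HB.instance Definition _ (r s : nat) (X Y : 'M[R]_(r + s)) :=
  GRing.isLinear.Build R _ _ _ (schedule X Y) (schedule_linear X Y).

(** The linear part of [lift_Delta], isolated so that composition with [schedule] yields the linear
    map of an affine schedule. *)
Definition lift_lin r s (D : 'M[R]_(r, s)) : 'M[R]_(r + s) := block_mx 0 (2 *: D) 0 0.

Lemma lift_lin_linear r s : linear (@lift_lin r s).
Proof.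
move=> a A B; rewrite /lift_lin scale_block_mx add_block_mx !scaler0 !addr0.
by rewrite scalerDr !scalerA mulrC.
Qed.

HB.instance Definition _ (r s : nat) :=
  GRing.isLinear.Build R _ _ _ (@lift_lin r s) (@lift_lin_linear r s).

Lemma lift_DeltaE r s (D : 'M[R]_(r, s)) : lift_Delta D = lift_Delta 0 + lift_lin D.
Proof. by rewrite /lift_Delta /lift_lin scaler0 add_block_mx !addr0 add0r. Qed.

Variables (n r s mp kp m k : nat).
Variables (V : 'M[R]_(r, s) -> Prop) (G : plant R n r s mp kp m k) (gamma : R).

(** Invertibility of [X1 - invmx Y1] follows from the coupling condition by a Schur complement; for
    [X2] and [Y2] it is assumed. All congruence matrices are then invertible and every inequality
    can be transported back. *)
Lemma analysis_of_regular_design (X1 Y1 : 'M[R]_n) (X2 Y2 : 'M[R]_(r + s)) T Z :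
  (exists Delta, V Delta) ->
  design_lmis V G gamma X1 Y1 X2 Y2 T Z -> X2 - invmx Y2 \in unitmx ->
  exists (K : controller R r s n (r + s) (r + s) m k) Xc P,
    affine_sched V K /\ analysis_lmis V G gamma K Xc P Z.
Proof.
move=> V0 [[/symmxP sX1 /symmxP sY1]].
case=> /(primal_scalingP _ V0)[sX2 pX2] /(dual_scalingP _ V0)[sY2 pY2].
case=> pZ tZ /posdefP[sXX pXX]; set GL := lift_plant G.
have [D0 VD0] := V0; have /posdefP[sZ _] := pZ.
have sNXX : (- block_mx Y1 1%:M 1%:M X1)^T = - block_mx Y1 1%:M 1%:M X1.
  by rewrite linearN /= sXX.
case=> /(lmi1P _ _ (trmx1 _ _) (trmx1 _ _)) q1 /(lmi2P _ sNXX (trmx1 _ _) sZ) q2 uS2.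
have uY1 : Y1 \in unitmx.
  by have := posform_unit (posform_ulsub pXX); rewrite block_mxKul.
have uY2 : Y2 \in unitmx.
  by have := posform_unit (pY2 _ VD0); rewrite unitmx_mul => /andP[].
have uU1 : invmx Y1 - X1 \in unitmx.
  by rewrite -opprB -scaleN1r unitmxZ ?unitrN1 //; apply/posform_unit/schur_posform.
have uU2 : invmx Y2 - X2 \in unitmx by rewrite -opprB -scaleN1r unitmxZ ?unitrN1.
set U1 := invmx Y1 - X1 in uU1; set U2 := invmx Y2 - X2 in uU2.
pose K := controller_of_design GL X1 U1 Y1 Y1 X2 U2 Y2 Y2 T
  (fun Delta => schedule X2 Y2 (lift_Delta Delta))
  (invmx U1) (invmx Y1) (invmx U2) (invmx Y2).
have SE := design_sysE GL U1 Y1 Y1 U2 Y2 Y2 K sX1 sX2.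
rewrite design_of_controllerK ?mulmxV ?mulVmx // !glue_left_factor // in SE.
set T1 := right_factor Y1 Y1 in SE; set T2 := right_factor Y2 Y2 in SE.
have uT1 : T1 \in unitmx by apply: right_factor_unitmx.
have uT2 : T2 \in unitmx by apply: right_factor_unitmx.
exists K, (glue X1 Y1), (glue X2 Y2); split.
  exists (schedule X2 Y2 (lift_Delta 0)), (schedule X2 Y2 \o @lift_lin r s).
  by move=> Delta _; rewrite /= -linearD -lift_DeltaE.
have sXc := glue_sym sX1 sY1; have sP := glue_sym sX2 sY2.
split=> //.
- apply/posdefP; split=> //; apply: (posform_congrW uT1); by rewrite glue_congr.
- apply/closed_loop_scalingP; split=> // Delta VD; apply: (posform_congrW uT2).
  rewrite mulmxA -glue_left_factor // -mulmxA mulmx_block.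
  rewrite mulmx_block !mul0mx !mulmx0 !mulmx1 !addr0 !add0r !mul1mx.
  (* The lower left block reduces to minus the transpose of the upper right block
     [lift_Delta Delta]; the diagonal blocks carry the dual and the primal scaling conditions. *)
  rewrite mulmxA [_ *m (_ *m Y2)]mulmxA scheduleK // opprD.
  rewrite addrCA subrr addr0 mulmx0 addr0.
  apply: posform_skew_block; last exact: pX2.
  by have := posform_tr (pY2 _ VD); rewrite trmx_mul trmxK sY2.
- apply/(lmi1P _ _ sXc sP); move: q1; rewrite SE form1_transf -mulNmx -mulmxN.
  by apply: posform_congrW; rewrite !block_diag_unitmx ?unitmx1.
- have sNXc : (- glue X1 Y1)^T = - glue X1 Y1 by rewrite linearN /= sXc.
  apply/(lmi2P _ sNXc sP sZ); move: q2.
  rewrite SE -glue_congr // -mulNmx -mulmxN form2_transf -mulNmx -mulmxN.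
  by apply: posform_congrW; rewrite block_diag_unitmx.
Qed.

(** [X2] is shifted by a small multiple of the identity. Three conditions are open and survive: the
    two performance inequalities and negativity on the image of [(I; 0)]. *)
Lemma regular_design (X1 Y1 : 'M[R]_n) (X2 Y2 : 'M[R]_(r + s)) T Z :
  (exists Delta, V Delta) ->
  design_lmis V G gamma X1 Y1 X2 Y2 T Z ->
  exists (X2' : 'M[R]_(r + s)) T',
    design_lmis V G gamma X1 Y1 X2' Y2 T' Z /\ X2' - invmx Y2 \in unitmx.
Proof.
move=> V0 [[/symmxP sX1 /symmxP sY1]].
case=> -[/symmxP sX2 /negdefP[sJ pJ] pX2] dY2.
case=> pZ tZ /posdefP[sXX pXX]; set GL := lift_plant G.
have /posdefP[sZ _] := pZ.
have sNXX : (- block_mx Y1 1%:M 1%:M X1)^T = - block_mx Y1 1%:M 1%:M X1.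
  by rewrite linearN /= sXX.
case=> /(lmi1P _ _ (trmx1 _ _) (trmx1 _ _)) q1 /(lmi2P _ sNXX (trmx1 _ _) sZ) q2.
have shift0 e : X1 + (e * 0)%:M = X1 by rewrite mulr0 raddf0 addr0.
pose T' e := perturb_design T (e *: 0) (e *: 0).
have [e1 e1_gt0 he1] : exists2 e0, 0 < e0 & forall e, 0 < e <= e0 ->
    posform (- form1 (design_sys GL X1 Y1 (X2 + e%:M) Y2 (T' e)) 1%:M 1%:M gamma).
  have [e0 e0_gt0 he] := posform_open (- block_mx
      (block_mx (block_mx 0 0 0 (0 *: pA11 GL)) (block_mx 0 0 0 (0 *: pA12 GL))
                (block_mx 0 0 0 (1 *: pA21 GL)) (block_mx 0 0 0 (1 *: pA22 GL)))
      (col_mx (col_mx 0 (0 *: pBp1 GL)) (col_mx 0 (1 *: pBp2 GL))) 0 0) q1.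
  exists e0; first exact: e0_gt0.
  move=> e /he; rewrite scalerN -opprD.
  have := form1_perturb GL X1 Y1 X2 Y2 T 0 1 0 0 gamma e.
  by rewrite shift0 mulr1 /T' => ->.
have [e2 e2_gt0 he2] : exists2 e0, 0 < e0 & forall e, 0 < e <= e0 ->
    posform (- form2 (design_sys GL X1 Y1 (X2 + e%:M) Y2 (T' e))
      (- block_mx Y1 1%:M 1%:M X1) 1%:M Z).
  have [e0 e0_gt0 he] := posform_open (- block_mx (block_mx 0 0 0 (- 0%:M)) 0
           (2 *: block_mx 0 0 0 (1 *: pA21 GL))
           (2 *: block_mx 0 0 0 (1 *: pA22 GL))) q2.
  exists e0; first exact: e0_gt0.
  move=> e /he; rewrite scalerN -opprD.
  have := form2_perturb GL X1 Y1 X2 Y2 T 0 1 0 0 Z e.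
  by rewrite shift0 mulr1 /T' => ->.
have [e3 e3_gt0 he3] := posform_open
  (- ((col_mx 1%:M 0)^T *m 1%:M *m (col_mx 1%:M 0 : 'M_(r + s, r)))) pJ.
have e_gt0 : 0 < Num.min e1 (Num.min e2 e3) by rewrite !lt_min e1_gt0 e2_gt0.
have [e] := shift_unitmx (X2 - invmx Y2) e_gt0.
rewrite !le_min => /and4P[e_0 le1 le2 le3] ue.
exists (X2 + e%:M), (T' e); split; last by rewrite addrAC.
have sX2e : (X2 + e%:M)^T = X2 + e%:M by rewrite linearD /= tr_scalar_mx sX2.
split=> //; first by split; apply/symmxP.
- split=> //; split; first exact/symmxP.
    apply/negdefP; split; first exact: congr_sym.
    have := he3 e; rewrite e_0 le3 => /(_ isT).
    by rewrite -[e%:M]scalemx1 mulmxDr mulmxDl -scalemxAr -scalemxAl opprD scalerN.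
  (* A positive shift only increases this form, so no bound uniform over the hull has to be
     found. *)
  move=> Delta VD; apply/posdefP; split; first exact: congr_sym.
  have /posdefP[_ p] := pX2 _ VD; move=> x /p.
  rewrite !quad_congr -(scalemx1 _ e) [X in _ -> _ < X]bilDm bilZm => h.
  by rewrite ltr_pwDl // mulr_ge0 ?quad1_ge0 // ltW.
- exact/posdefP.
- split.
    by apply/(lmi1P _ _ (trmx1 _ _) (trmx1 _ _)); apply: he1; rewrite e_0.
  by apply/(lmi2P _ sNXX (trmx1 _ _) sZ); apply: he2; rewrite e_0.
Qed.

End Sufficiency.

Theorem theorem3 (R : realType) (n r s mp kp m k N : nat)
    (Deltas : 'I_N -> 'M[R]_(r, s))
    (hull0 : conv_hull Deltas 0)
    (G : plant R n r s mp kp m k)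
    (gamma : R) (gamma_gt0 : 0 < gamma) :
  ((exists (nc lc : nat) (K : controller R r s nc lc lc m k)
      (X1 : 'M[R]_(n + nc)) (P : 'M[R]_((r + s) + lc)) (Z : 'M[R]_kp),
      analysis_lmis (conv_hull Deltas) G gamma K X1 P Z)
   <->
   (exists (X1 Y1 : 'M[R]_n) (X2 Y2 : 'M[R]_(r + s))
      (T : design_params R n (r + s) m k) (Z : 'M[R]_kp),
      design_lmis (conv_hull Deltas) G gamma X1 Y1 X2 Y2 T Z))
  /\
  (forall (X1 Y1 : 'M[R]_n) (X2 Y2 : 'M[R]_(r + s))
      (T : design_params R n (r + s) m k) (Z : 'M[R]_kp),
    design_lmis (conv_hull Deltas) G gamma X1 Y1 X2 Y2 T Z ->
    exists (nc lc : nat) (K : controller R r s nc lc lc m k)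
      (Xc : 'M[R]_(n + nc)) (P : 'M[R]_((r + s) + lc)),
      [/\ (nc <= n)%N, (lc <= r + s)%N,
          affine_sched (conv_hull Deltas) K &
          analysis_lmis (conv_hull Deltas) G gamma K Xc P Z]).
Proof.
have V0 : exists Delta, conv_hull Deltas Delta by exists 0.
have suff_ X1 Y1 X2 Y2 T Z : design_lmis (conv_hull Deltas) G gamma X1 Y1 X2 Y2 T Z ->
    exists (K : controller R r s n (r + s) (r + s) m k) Xc P,
      affine_sched (conv_hull Deltas) K /\
      analysis_lmis (conv_hull Deltas) G gamma K Xc P Z.
  move=> /(regular_design V0)[X2' [T' [dT' uX2']]].
  exact: (analysis_of_regular_design V0 dT' uX2').
split; first split.
- move=> [nc [lc [K [Xc [P [Z]]]]]].
  move=> /(design_of_analysis V0)[X1 [Y1 [X2 [Y2 [T dT]]]]].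
  by exists X1, Y1, X2, Y2, T, Z.
- move=> [X1 [Y1 [X2 [Y2 [T [Z /suff_[K [Xc [P [_ aK]]]]]]]]]].
  by exists n, (r + s)%N, K, Xc, P, Z.
- move=> X1 Y1 X2 Y2 T Z /suff_[K [Xc [P [affK aK]]]].
  by exists n, (r + s)%N, K, Xc, P; split.
Qed.
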